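(* Let $X$ and $Y$ be tropical fans of the same dimension $n$ in $V=\Lambda\otimes\mathbb{R}$ and $V'=\Lambda'\otimes\mathbb{R}$, respectively, and let $f:X\to Y$ be a morphism of fans. Assume that $Y$ is irreducible. Then there is a fan $Y_0$ in $V'$ of dimension smaller than $n$ with $|Y_0|\subset|Y|$ such that: (a) each point $Q\in|Y|\setminus|Y_0|$ lies in the (relative) interior of a cone $\sigma'_Q\in Y$ of dimension $n$; (b) each point $P\in f^{-1}(|Y|\setminus|Y_0|)$ lies in the (relative) interior of a cone $\sigma_P\in X$ of dimension $n$; (c) for $Q\in|Y|\setminus|Y_0|$ the sum $$\sum_{P\in|X|:\, f(P)=Q}\operatorname{mult}_P f$$ does not depend on $Q$, where the multiplicity of $f$ at $P$ is defined to be $$\operatorname{mult}_P f:=\frac{\omega_X(\sigma_P)}{\omega_Y(\sigma'_Q)}\cdot\bigl|\Lambda'_{\sigma'_Q}/f(\Lambda_{\sigma_P})\bigr|.$$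
   Context: $\Lambda,\Lambda'$ are finitely generated free abelian groups, $V=\Lambda\otimes_{\mathbb{Z}}\mathbb{R}$, $V'=\Lambda'\otimes_{\mathbb{Z}}\mathbb{R}$. Cones. A cone in $V$ is a set $\sigma=\{x\in V: f_i(x)=0\ (i=1,\dots,p),\ g_j(x)\ge 0\ (j=1,\dots,m)\}$ with $f_i,g_j\in\Lambda^\vee$ (it may contain lines). $V_\sigma$ is the smallest linear subspace containing $\sigma$, $\Lambda_\sigma:=V_\sigma\cap\Lambda$, $\dim\sigma:=\dim V_\sigma$. A face $\tau\le\sigma$ is a cone obtained by changing some (possibly none) of the inequalities $g_j\ge 0$ into equalities; $\tau<\sigma$ means additionally $\tau\neq\sigma$. If $\tau<\sigma$ and $\dim\tau=\dim\sigma-1$, the primitive normal vector $u_{\sigma/\tau}\in\Lambda_\sigma/\Lambda_\tau\cong\mathbb{Z}$ is the unique generator lying in the half-space of $V_\sigma/V_\tau\cong\mathbb{R}$ that contains the image of $\sigma$. Fans. A fan $X$ in $V$ is a finite set of cones in $V$, closed under taking faces, such that the intersection of any two cones of $X$ is a face of each. $X^{(k)}$ is the set of $k$-dimensional cones of $X$, $|X|$ the union of all cones, $\dim X$ the maximal dimension of a cone; $X$ is pure-dimensional if all inclusion-maximal cones have dimension $\dim X$. The empty set of cones counts as a fan, of dimension smaller than that of any non-empty fan. Weighted and tropical fans. A weighted fan is a pair $(X,\omega_X)$ with $X$ a fan of some pure dimension $n$ and $\omega_X:X^{(n)}\to\mathbb{Z}_{>0}$. It is a tropical fan if for all $\tau\in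 X^{(n-1)}$ the balancing condition $\sum_{\sigma>\tau}\omega_X(\sigma)\,u_{\sigma/\tau}=0\in V/V_\tau$ holds (sum over $\sigma\in X^{(n)}$ with $\sigma>\tau$). A tropical fan $X$ in $V$ is irreducible if there is no tropical fan $Z$ of the same dimension in $V$ with $|Z|\subsetneq|X|$. A morphism of fans $f:X\to Y$ ($X$ a fan in $V$, $Y$ a fan in $V'$) is a map $f:|X|\to|Y|$ that is $\mathbb{Z}$-linear, i.e. induced by a linear map $\Lambda\to\Lambda'$; the linear maps $\Lambda\to\Lambda'$ and $V\to V'$ are also denoted $f$. There is no condition on weights, and cones need not map into cones. In (c), $Q=f(P)$; for $P\in f^{-1}(|Y|\setminus |Y_0|)$ the linear map $f$ sends $V_{\sigma_P}$ into $V'_{\sigma'_Q}$, and $|\cdot|$ of a quotient group denotes its order. *)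

(* Defs.v *)
From HB Require Import structures.
From mathcomp Require Import all_boot all_order all_algebra finmap.
From mathcomp Require Import all_classical all_reals topology normedtype.

Set Implicit Arguments.
Unset Strict Implicit.
Unset Printing Implicit Defensive.

Import Order.TTheory GRing.Theory Num.Theory.
Import numFieldNormedType.Exports.

Local Open Scope classical_set_scope.
Local Open Scope ring_scope.

(* A finitely generated free abelian group of rank r is given, after a choice
   of basis, as 'rV[int]_r; then its real extension is 'rV[R]_r, its dual is
   'cV[int]_r, and a homomorphism to 'rV[int]_r' is right multiplication by a
   matrix in 'M[int]_(r, r'). *)

Definition extend_scalars (R : realType) (m n : nat)
    (A : 'M[int]_(m, n)) : 'M[R]_(m, n) := map_mx intr A.

Definition dual_eval (R : realType) (r : nat) (l : 'cV[int]_r)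
    (x : 'rV[R]_r) : R := (x *m extend_scalars R l) 0 0.

(* The inequalities g_j >= 0 with j in J are turned into equalities. *)
Definition presented_cone (R : realType) (r p m : nat)
    (f : 'I_p -> 'cV[int]_r) (g : 'I_m -> 'cV[int]_r) (J : {set 'I_m}) :
    set 'rV[R]_r :=
  [set x | (forall i, dual_eval (f i) x = 0) /\
           (forall j, if j \in J then dual_eval (g j) x = 0
                      else 0 <= dual_eval (g j) x)].

Definition is_cone (R : realType) (r : nat) (s : set 'rV[R]_r) : Prop :=
  exists (p m : nat) (f : 'I_p -> 'cV[int]_r) (g : 'I_m -> 'cV[int]_r),
    s = presented_cone f g finset.set0.

(* The set of faces of s is the same for every presentation of s. *)
Definition is_face (R : realType) (r : nat) (t s : set 'rV[R]_r) : Prop :=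
  exists (p m : nat) (f : 'I_p -> 'cV[int]_r) (g : 'I_m -> 'cV[int]_r)
         (J : {set 'I_m}),
    s = presented_cone f g finset.set0 /\ t = presented_cone f g J.

Definition is_proper_face (R : realType) (r : nat) (t s : set 'rV[R]_r) :
    Prop := is_face t s /\ t <> s.

Definition is_smallest_subspace (R : realType) (r : nat) (s : set 'rV[R]_r)
    (U : {vspace 'rV[R]_r}) : Prop :=
  s `<=` [set` U] /\
  forall W : {vspace 'rV[R]_r}, s `<=` [set` W] -> (U <= W)%VS.

Lemma smallest_subspace_exists (R : realType) (r : nat) (s : set 'rV[R]_r) :
  exists U, is_smallest_subspace s U.
Proof.
pose P k := `[< exists U : {vspace 'rV[R]_r}, s `<=` [set` U] /\ \dim U = k >].
have exP : exists k, P k.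
  by exists (\dim {:'rV[R]_r}); apply/asboolP; exists fullv; split=> // x _ /=;
    rewrite memvf.
case: (ex_minnP exP) => k /asboolP[U [sU dU]] kmin.
exists U; split=> // W sW.
have sUW : s `<=` [set` (U :&: W)%VS].
  by move=> x sx; rewrite /= memv_cap; apply/andP; split; [exact: sU|exact: sW].
have le_k : (k <= \dim (U :&: W))%N.
  by apply: kmin; apply/asboolP; exists (U :&: W)%VS.
have /eqP <- : (U :&: W == U)%VS by rewrite eqEdim capvSl /= dU.
exact: capvSr.
Qed.

Definition cone_span (R : realType) (r : nat) (s : set 'rV[R]_r) :
    {vspace 'rV[R]_r} := xget 0%VS (is_smallest_subspace s).

Lemma cone_spanP (R : realType) (r : nat) (s : set 'rV[R]_r) :
  is_smallest_subspace s (cone_span s).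
Proof.
by rewrite /cone_span; case: xgetP => [U -> //|no];
  have [U sU] := smallest_subspace_exists s; case: (no U).
Qed.

Definition cone_lattice (R : realType) (r : nat) (s : set 'rV[R]_r) :
    set 'rV[int]_r := [set z | extend_scalars R z \in cone_span s].

Definition cone_dim (R : realType) (r : nat) (s : set 'rV[R]_r) : nat :=
  \dim (cone_span s).

(* With V_s for cone_span s and Lambda_s for cone_lattice s: the class of u
   generates Lambda_s / Lambda_t and lies in the half-space l >= 0 of
   V_s / V_t which contains the image of s. *)
Definition lifts_primitive_normal (R : realType) (r : nat)
    (s t : set 'rV[R]_r) (u : 'rV[int]_r) : Prop :=
  [/\ cone_lattice s u,
      forall v, cone_lattice s v -> exists k : int, cone_lattice t (v - u *~ k)
    & exists l : 'cV[R]_r,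
        [/\ forall x, x \in cone_span t -> x *m l = 0,
            exists2 x, x \in cone_span s & x *m l != 0,
            forall x, s x -> 0 <= (x *m l) 0 0
          & 0 <= (extend_scalars R u *m l) 0 0]].

(* A representative in Lambda_s of u_{s/t}, which is only defined modulo
   Lambda_t; relevant for facets t of s. *)
Definition primitive_normal (R : realType) (r : nat) (s t : set 'rV[R]_r) :
    'rV[int]_r := xget 0 (lifts_primitive_normal s t).

Definition is_fan (R : realType) (r : nat) (X : set (set 'rV[R]_r)) : Prop :=
  [/\ finite_set X,
      forall s, X s -> is_cone s,
      forall s t, X s -> is_face t s -> X t
    & forall s t, X s -> X t -> is_face (s `&` t) s /\ is_face (s `&` t) t].

Definition fan_cones (R : realType) (r : nat) (X : set (set 'rV[R]_r))
    (k : nat) : set (set 'rV[R]_r) := [set s | X s /\ cone_dim s = k].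

Definition fan_support (R : realType) (r : nat) (X : set (set 'rV[R]_r)) :
    set 'rV[R]_r := \bigcup_(s in X) s.

Definition has_fan_dim (R : realType) (r : nat) (X : set (set 'rV[R]_r))
    (n : nat) : Prop :=
  (exists s, fan_cones X n s) /\ forall s, X s -> (cone_dim s <= n)%N.

(* Holds for the empty fan and every n. *)
Definition fan_dim_lt (R : realType) (r : nat) (X : set (set 'rV[R]_r))
    (n : nat) : Prop := forall s, X s -> (cone_dim s < n)%N.

Definition has_pure_dim (R : realType) (r : nat) (X : set (set 'rV[R]_r))
    (n : nat) : Prop :=
  has_fan_dim X n /\
  forall s, X s -> (forall t, X t -> s `<=` t -> t = s) -> cone_dim s = n.

(* Only the values of w on the n-dimensional cones of X matter. *)
Definition is_weighted_fan (R : realType) (r n : nat)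
    (X : set (set 'rV[R]_r)) (w : set 'rV[R]_r -> int) : Prop :=
  [/\ is_fan X, has_pure_dim X n & forall s, fan_cones X n s -> 0 < w s].

(* Vanishing in V / V_t is membership in V_t; the codimension one condition is
   written so that there is no such t for n = 0. *)
Definition is_tropical_fan (R : realType) (r n : nat)
    (X : set (set 'rV[R]_r)) (w : set 'rV[R]_r -> int) : Prop :=
  is_weighted_fan n X w /\
  forall t, X t -> (cone_dim t).+1 = n ->
    \sum_(s \in [set s | fan_cones X n s /\ is_proper_face t s])
      (w s)%:~R *: extend_scalars R (primitive_normal s t) \in cone_span t.

Definition irreducible_fan (R : realType) (r n : nat)
    (X : set (set 'rV[R]_r)) : Prop :=
  ~ exists (Z : set (set 'rV[R]_r)) (w : set 'rV[R]_r -> int),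
      is_tropical_fan n Z w /\ fan_support Z `<` fan_support X.

Definition is_fan_morphism (R : realType) (r r' : nat)
    (X : set (set 'rV[R]_r)) (Y : set (set 'rV[R]_r'))
    (f : 'M[int]_(r, r')) : Prop :=
  forall x, fan_support X x -> fan_support Y (x *m extend_scalars R f).

(* Interior of s in the subspace topology of V_s. *)
Definition relint (R : realType) (r : nat) (s : set 'rV[R]_r) :
    set 'rV[R]_r :=
  [set x | s x /\ \forall y \near x, y \in cone_span s -> s y].

Definition quotient_set (r : nat) (A B : set 'rV[int]_r) :
    set (set 'rV[int]_r) :=
  [set C | exists2 a, A a & C = [set a + b | b in B]].

(* The order of A / B; equal to 0 if it is infinite. *)
Definition quotient_order (r : nat) (A B : set 'rV[int]_r) : nat :=
  #|` fset_set (quotient_set A B)|%fset.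

Definition lattice_image (R : realType) (r r' : nat) (f : 'M[int]_(r, r'))
    (s : set 'rV[R]_r) : set 'rV[int]_r' := [set z *m f | z in cone_lattice s].

(* mult_P f, for s = sigma_P and s' = sigma'_Q with Q = f(P). *)
Definition multiplicity (R : realType) (r r' : nat)
    (wX : set 'rV[R]_r -> int) (wY : set 'rV[R]_r' -> int)
    (f : 'M[int]_(r, r')) (s : set 'rV[R]_r) (s' : set 'rV[R]_r') : rat :=
  (wX s)%:~R / (wY s')%:~R *
  (quotient_order (cone_lattice s') (lattice_image f s))%:R.

Definition fiber (R : realType) (r r' : nat) (X : set (set 'rV[R]_r))
    (f : 'M[int]_(r, r')) (Q : 'rV[R]_r') : set 'rV[R]_r :=
  [set P | fan_support X P /\ P *m extend_scalars R f = Q].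

(* Main.v *)
Require Import Defs.
From HB Require Import structures.
From mathcomp Require Import all_boot all_order all_algebra finmap.
From mathcomp Require Import all_classical all_reals topology normedtype.
From mathcomp Require Import lra ring zify.

(** The weights of X are pushed forward along f and compared with those of Y.

    Choose finitely many integral linear forms A on V', so many that the
    following sets are unions of cells of the hyperplane arrangement A: the
    subspace f(V_s) for every cone s of X, the cone f(s) whenever f is injective
    on V_s, and every cone of Y ([adapted_exists], applied to f and to the
    identity of V').  Let Y_0 consist of the cells in |Y| of dimension less
    than n.  If Q lies in |Y| but not in |Y_0|, its cell k has dimension n, and
    this forces every cone of X through a point of the fibre over Q to be
    n-dimensional and to be mapped injectively onto a cone containing k.  Hence
    the fibre is in bijection with the n-dimensional cones s of X such that k
    lies in f(s) ([cone_through_bij]), and the sum of the multiplicities is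
    N(k) / w_Y, where N(k) is the sum of w_X(s) [L_k : f(L_s)] over these cones
    s, and L_k is the lattice of k ([pushforward_weight]).

    The function N is a balanced weight on the n-dimensional cells
    ([pushforward_balanced]).  Indeed, let t be a cell of dimension n - 1 and y
    a point of its interior.  If an n-dimensional cone s has y in its image,
    there are two possibilities ([local_balance]).  Either y comes from an
    interior point of s; then exactly two cells around t lie in f(s), and their
    normal vectors are opposite.  Or y comes from an interior point of a facet
    m of s; then exactly one cell k around t lies in f(s), and
    [L_k : f(L_s)] u_{k/t} is congruent to [L_t : f(L_m)] f(u_{s/m}) modulo
    V_t, by a comparison of indices ([index_facet]).  Collecting the terms that
    belong to the same facet m, one recognises the image under f of the
    balancing condition of X at m.  The same theorem for the identity of Y says
    that the weights w_Y, transported to the cells, are balanced.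

    If c is the minimum of N / w_Y over the n-dimensional cells in |Y|, the
    weight N - c w_Y is balanced, nonnegative, and zero on some cell.  The cells
    on which it is positive therefore span a tropical fan that is smaller than
    |Y|, unless there are none ([irreducible_weight_unique]).  Irreducibility
    leaves only N = c w_Y, which is the claim. *)

Set Implicit Arguments.
Unset Strict Implicit.
Unset Printing Implicit Defensive.

Import Order.TTheory GRing.Theory Num.Theory.
Import numFieldNormedType.Exports.

Local Open Scope classical_set_scope.
Local Open Scope ring_scope.

(** * Integral linear forms *)
Section LinearForms.
Variables (R : realType) (r : nat).
Implicit Types (h : 'cV[int]_r) (x y z v : 'rV[R]_r).

Lemma evalD h x y : dual_eval h (x + y) = dual_eval h x + dual_eval h y.
Proof. by rewrite /dual_eval mulmxDl mxE. Qed.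

Lemma evalZ h (a : R) x : dual_eval h (a *: x) = a * dual_eval h x.
Proof. by rewrite /dual_eval -scalemxAl mxE. Qed.

Lemma evalN h x : dual_eval h (- x) = - dual_eval h x.
Proof. by rewrite -scaleN1r evalZ mulN1r. Qed.

Lemma eval0 h : dual_eval h (0 : 'rV[R]_r) = 0.
Proof. by rewrite /dual_eval mul0mx mxE. Qed.

Lemma eval0l x : dual_eval 0 x = 0.
Proof. by rewrite /dual_eval /extend_scalars raddf0 mulmx0 mxE. Qed.

Lemma evalDl h h' x : dual_eval (h + h') x = dual_eval h x + dual_eval h' x.
Proof. by rewrite /dual_eval /extend_scalars raddfD mulmxDr mxE. Qed.

Lemma evalNl h x : dual_eval (- h) x = - dual_eval h x.
Proof. by rewrite /dual_eval /extend_scalars raddfN mulmxN mxE. Qed.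

Lemma eval_suml (I : finType) (P : pred I) (g : I -> 'cV[int]_r) x :
  dual_eval (\sum_(i | P i) g i) x = \sum_(i | P i) dual_eval (g i) x.
Proof.
elim/big_ind2: _ => [|h a h' b <- <-|//]; first exact: eval0l.
exact: evalDl.
Qed.

Lemma extend_scalarsD (m k : nat) (M M' : 'M[int]_(m, k)) :
  extend_scalars R (M + M') = extend_scalars R M + extend_scalars R M'.
Proof. exact: raddfD. Qed.

Lemma extend_scalarsN (m k : nat) (M : 'M[int]_(m, k)) :
  extend_scalars R (- M) = - extend_scalars R M.
Proof. exact: raddfN. Qed.

Lemma extend_scalarsM (m k l : nat) (M : 'M[int]_(m, k)) (M' : 'M[int]_(k, l)) :
  extend_scalars R (M *m M') = extend_scalars R M *m extend_scalars R M'.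
Proof. exact: map_mxM. Qed.

Lemma extend_scalars_mulz (m k : nat) (M : 'M[int]_(m, k)) (c : int) :
  extend_scalars R (M *~ c) = c%:~R *: extend_scalars R M.
Proof. by rewrite /extend_scalars raddfMz scaler_int. Qed.

Lemma extend_scalars_inj (m k : nat) :
  injective (@extend_scalars R m k).
Proof.
move=> M N /matrixP MN; apply/matrixP => i j.
by have := MN i j; rewrite !mxE => /intr_inj.
Qed.

Lemma eval_extend h (u : 'rV[int]_r) :
  dual_eval h (extend_scalars R u) = ((u *m h) 0 0)%:~R.
Proof. by rewrite /dual_eval -extend_scalarsM mxE. Qed.

Lemma eval_mulmx (r' : nat) (M : 'M[int]_(r', r)) h (x : 'rV[R]_r') :
  dual_eval (M *m h) x = dual_eval h (x *m extend_scalars R M).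
Proof. by rewrite /dual_eval extend_scalarsM mulmxA. Qed.

(** A form that does not vanish at [y] keeps its sign on a short segment around
    [y]; a finite set of forms admits a common length. *)
Lemma small_step (H : seq 'cV[int]_r) y v :
  exists2 e : R, 0 < e & forall t, `|t| <= e -> forall h, h \in H ->
    (0 < dual_eval h y -> 0 < dual_eval h (y + t *: v)) /\
    (dual_eval h y < 0 -> dual_eval h (y + t *: v) < 0).
Proof.
elim: H => [|h H [e e0 eH]]; first by exists 1.
have [hy|hy] := eqVneq (dual_eval h y) 0.
  exists e => // t te h'; rewrite inE => /orP[/eqP ->|]; last exact: eH.
  by rewrite hy ltxx.
pose d := `|dual_eval h y| / (1 + `|dual_eval h v|).
have d0 : 0 < d by rewrite divr_gt0 ?normr_gt0 // ltr_pwDl.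
exists (Num.min e d); first by rewrite lt_min e0.
move=> t; rewrite le_min => /andP[te td] h'; rewrite inE => /orP[/eqP ->|];
  last exact: eH.
have lt_h : `|t * dual_eval h v| < `|dual_eval h y|.
  have den0 : 0 < 1 + `|dual_eval h v| by rewrite ltr_pwDl.
  rewrite normrM; apply: (@le_lt_trans _ _ (d * `|dual_eval h v|)).
    by rewrite ler_wpM2r.
  rewrite /d mulrAC ltr_pdivrMr // ltr_pM2l ?normr_gt0 //.
  by rewrite ltrDr.
rewrite evalD evalZ; move: lt_h; set a := _ * _; set b := dual_eval h y.
rewrite ltr_norml => /andP[]; split=> hb.
  by move: (gtr0_norm hb) => E; lra.
by move: (ltr0_norm hb) => E; lra.
Qed.

End LinearForms.

(** * Cells of a hyperplane arrangement *)
Section Cells.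
Variables (R : realType) (r : nat).
Implicit Types (h : 'cV[int]_r) (x y z v : 'rV[R]_r) (H : seq 'cV[int]_r).

(** The closed cell of the arrangement [H] whose relative interior contains
    [y].  Encoding a cell by one of its interior points makes inclusion of
    cells the same as membership of points. *)
Definition cell H y : set 'rV[R]_r :=
  [set z | forall h, h \in H ->
     (0 <= dual_eval h y -> 0 <= dual_eval h z) /\
     (dual_eval h y <= 0 -> dual_eval h z <= 0)].

Lemma cell_refl H y : cell H y y.
Proof. by move=> h. Qed.

Lemma cell_trans H x y z : cell H x y -> cell H y z -> cell H x z.
Proof.
move=> xy yz h hH; have [xy1 xy2] := xy h hH; have [yz1 yz2] := yz h hH.
by split=> [/xy1/yz1|/xy2/yz2].
Qed.

Lemma sub_cell H x y : cell H x y -> cell H y `<=` cell H x.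
Proof. by move=> xy z; apply: cell_trans. Qed.

Lemma cell0 H y : cell H y 0.
Proof. by move=> h _; rewrite eval0. Qed.

Lemma cellD H x y z : cell H x y -> cell H x z -> cell H x (y + z).
Proof.
move=> xy xz h hH; have [xy1 xy2] := xy h hH; have [xz1 xz2] := xz h hH.
rewrite evalD; split=> [h0|h0]; first by rewrite addr_ge0 ?xy1 ?xz1.
by rewrite -oppr_ge0 opprD addr_ge0 // oppr_ge0 ?xy2 ?xz2.
Qed.

Lemma cellZ H x y (a : R) : 0 <= a -> cell H x y -> cell H x (a *: y).
Proof.
move=> a0 xy h hH; have [xy1 xy2] := xy h hH.
rewrite evalZ; split=> h0; first by rewrite mulr_ge0 ?xy1.
by rewrite mulr_ge0_le0 ?xy2.
Qed.

(** The vectors of the smallest intersection of hyperplanes of [H] through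
    [y]. *)
Definition flat H y v := forall h, h \in H -> dual_eval h y = 0 ->
  dual_eval h v = 0.

Lemma cell_flat H y z : cell H y z -> flat H y z.
Proof.
move=> yz h hH h0; have [yz1 yz2] := yz h hH.
by apply/eqP; rewrite eq_le yz1 ?yz2 // h0.
Qed.

(** [y] is an interior point of its cell relative to its flat. *)
Lemma flat_step H y v : flat H y v ->
  exists2 e : R, 0 < e & forall t, `|t| <= e -> cell H y (y + t *: v).
Proof.
move=> fv; have [e e0 eH] := small_step H y v; exists e => // t te h hH.
have [p1 p2] := eH t te h hH.
have [h0|h0|h0] := ltgtP (dual_eval h y) 0; split=> //.
- by move=> _; exact/ltW/p2.
- by move=> _; exact/ltW/p1.
- by rewrite evalD evalZ h0 (fv _ hH h0) mulr0 addr0.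
- by rewrite evalD evalZ h0 (fv _ hH h0) mulr0 addr0.
Qed.

Definition flat_mx H y : 'M[int]_(r, size H) :=
  \matrix_(k, i) (if dual_eval H`_i y == 0 then H`_i k 0 else 0).

Lemma flat_mxP H y v : v *m extend_scalars R (flat_mx H y) = 0 <-> flat H y v.
Proof.
have E i : (v *m extend_scalars R (flat_mx H y)) 0 i =
    if dual_eval H`_i y == 0 then dual_eval H`_i v else 0.
  rewrite mxE; case: ifP => h0.
    by rewrite /dual_eval mxE; apply: eq_bigr => k _; rewrite !mxE h0.
  by rewrite big1 // => k _; rewrite !mxE h0 mulr0.
split=> [/rowP v0 h hH h0|fv].
  have := v0 (Ordinal (etrans (index_mem h H) hH)).
  by rewrite E /= nth_index // h0 eqxx mxE.
apply/rowP => i; rewrite E mxE; case: eqP => // h0.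
by rewrite fv // mem_nth.
Qed.

(** The span is at most the flat because the flat is a kernel; it is all of it
    because [y + e v] stays in the cell for small [e]. *)
Lemma mem_cell_span H y v : (v \in cone_span (cell H y)) <-> flat H y v.
Proof.
have [sub min] := cone_spanP (cell H y); split=> [vs|fv].
  pose phi := linfun (mulmxr (extend_scalars R (flat_mx H y)) :
    {linear 'rV[R]_r -> 'rV[R]_(size H)}).
  have/min/subvP/(_ v vs) : cell H y `<=` [set` lker phi].
    by move=> x /= /cell_flat/flat_mxP fx; rewrite memv_ker lfunE /= fx.
  by rewrite memv_ker lfunE /= => /eqP/flat_mxP.
have [e e0 eH] := flat_step fv.
have ye : cell H y (y + e *: v) by apply: eH; rewrite ger0_norm // ltW.
have yy : cell H y y by [].
have -> : v = e^-1 *: ((y + e *: v) - y).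
  by rewrite addrAC subrr add0r scalerA mulVf ?gt_eqF // scale1r.
by rewrite memvZ // memvB //; apply: sub.
Qed.

Lemma separating_form H y v : v \notin cone_span (cell H y) ->
  exists h, [/\ h \in H, dual_eval h y = 0 & dual_eval h v <> 0].
Proof.
move=> nv; apply: contrapT => no; case/negP: nv; apply/mem_cell_span => h hH h0.
by apply: contrapT => hv; apply: no; exists h.
Qed.

Lemma cell_span_sub H x y : cell H x y ->
  (cone_span (cell H y) <= cone_span (cell H x))%VS.
Proof.
move=> xy; apply/subvP => v /mem_cell_span fv; apply/mem_cell_span => h hH h0.
by apply: fv => //; apply: (cell_flat xy).
Qed.

Lemma mem_span (s : set 'rV[R]_r) x : s x -> x \in cone_span s.
Proof. by have [sub _] := cone_spanP s; apply: sub. Qed.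

Lemma cone_span_mono (s t : set 'rV[R]_r) : s `<=` t ->
  (cone_span s <= cone_span t)%VS.
Proof.
move=> st; have [_ min] := cone_spanP s; apply: min => x /st.
exact: mem_span.
Qed.

Lemma cone_dim_mono (s t : set 'rV[R]_r) : s `<=` t ->
  (cone_dim s <= cone_dim t)%N.
Proof. by move=> /cone_span_mono; apply: dimvS. Qed.

Lemma cone_span_eq (s t : set 'rV[R]_r) : s `<=` t -> cone_dim s = cone_dim t ->
  cone_span s = cone_span t.
Proof.
by move=> st d; apply/eqP; rewrite eqEdim cone_span_mono //= -/(cone_dim s) d. Qed.

(** Equal dimensions mean equal flats, so that the forms vanishing at [x] and at
    [y] are the same ones; the signs of the others agree already. *)
Lemma cell_eq H x y : cell H x y -> (cone_dim (cell H x) <= cone_dim (cell H y))%N ->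
  cell H y = cell H x.
Proof.
move=> xy d; apply/seteqP; split; first exact: sub_cell.
apply: sub_cell => h hH.
have E : cone_span (cell H y) = cone_span (cell H x).
  by apply/eqP; rewrite eqEdim cell_span_sub.
have /mem_cell_span fx : x \in cone_span (cell H y).
  by rewrite E; apply: mem_span (cell_refl x).
have [xy1 xy2] := xy h hH; split=> hy.
  rewrite leNgt; apply/negP => hx; move: (hx); rewrite fx ?ltxx //.
  by apply/eqP; rewrite eq_le hy xy2 // ltW.
rewrite leNgt; apply/negP => hx; move: (hx); rewrite fx ?ltxx //.
by apply/eqP; rewrite eq_le hy xy1 // ltW.
Qed.

(** Forms of constant sign cannot cancel in a sum of points of the convex cone
    [t], so that adding one witness for each form not identically zero on [t]
    gives a point that witnesses all of them. *)
Lemma generic_point (t : set 'rV[R]_r) H :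
  t 0 -> (forall x y, t x -> t y -> t (x + y)) ->
  (forall h, h \in H -> (forall z, t z -> 0 <= dual_eval h z) \/
                       (forall z, t z -> dual_eval h z <= 0)) ->
  exists2 q, t q & forall h, h \in H -> dual_eval h q = 0 ->
    forall z, t z -> dual_eval h z = 0.
Proof.
move=> t0 tD; elim: H => [|h H IH] sgn; first by exists 0.
have {}IH : exists2 q, t q & forall h, h \in H -> dual_eval h q = 0 ->
    forall z, t z -> dual_eval h z = 0.
  by apply: IH => h' h'H; apply: sgn; rewrite inE h'H orbT.
have [q tq qH] := IH.
have [[z [tz hz]]|no] := pselect (exists z, t z /\ dual_eval h z <> 0); last first.
  exists q => // h'; rewrite inE => /orP[/eqP -> _ z tz|]; last exact: qH.
  by apply: contrapT => hz; apply: no; exists z.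
have split0 : forall h', h' \in h :: H -> dual_eval h' (q + z) = 0 ->
    dual_eval h' q = 0 /\ dual_eval h' z = 0.
  move=> h' /sgn; rewrite evalD; case=> S /eqP.
    by rewrite paddr_eq0 ?S // => /andP[/eqP-> /eqP->].
  by rewrite naddr_eq0 ?S // => /andP[/eqP-> /eqP->].
exists (q + z); first exact: tD.
move=> h' h'H /(split0 _ h'H) [q0 z0].
move: h'H; rewrite inE => /orP[/eqP E|h'H]; first by rewrite E in z0.
exact: qH.
Qed.

(** A convex union of cells inside a cell is the cell of its generic point. *)
Lemma subcell H x (t : set 'rV[R]_r) : t `<=` cell H x ->
  t 0 -> (forall y z, t y -> t z -> t (y + z)) ->
  (forall y, t y -> cell H y `<=` t) ->
  exists2 q, cell H x q & t = cell H q.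
Proof.
move=> tx t0 tD tcl.
have sgn h : h \in H -> (forall z, t z -> 0 <= dual_eval h z) \/
                       (forall z, t z -> dual_eval h z <= 0).
  move=> hH; case: (leP 0 (dual_eval h x)) => hx.
    by left=> z /tx/(_ h hH)[+ _]; apply.
  by right=> z /tx/(_ h hH)[_]; apply; apply: ltW.
have [q tq qH] := generic_point t0 tD sgn.
exists q; first exact: tx.
apply/seteqP; split=> [z tz h hH|]; last exact: tcl.
have [S|S] := sgn h hH; split=> // h0.
- exact: S.
- by rewrite (qH h hH _ _ tz) //; apply/eqP; rewrite eq_le h0 S.
- by rewrite (qH h hH _ _ tz) //; apply/eqP; rewrite eq_le h0 S.
- exact: S.
Qed.

(** Whatever the presentation, a face is cut out of the cone by a single form
    [l], nonnegative on the cone: the sum of the inequalities that are made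
    equalities.  The zeros of [l] are closed under passing to cells, because
    [l] is nonnegative at [y - e z] too when [z] is in the cell of [y]. *)
Lemma face_cell H p (t : set 'rV[R]_r) : is_face t (cell H p) ->
  exists2 q, cell H p q & t = cell H q.
Proof.
move=> [k [m [f [g [J [sE tE]]]]]].
pose l := \sum_(j in J) g j.
have gs z j : cell H p z -> 0 <= dual_eval (g j) z.
  by rewrite sE => -[_ /(_ j)]; rewrite finset.in_set0.
have ls z : cell H p z -> 0 <= dual_eval l z.
  by move=> sz; rewrite eval_suml sumr_ge0 // => j _; apply: gs.
have tP z : t z <-> cell H p z /\ dual_eval l z = 0.
  split=> [tz|[sz lz]].
    have sz : cell H p z.
      rewrite sE; rewrite tE in tz; case: tz => fz gz; split=> // j.
      by rewrite finset.in_set0; have := gz j; case: ifP => // _ ->.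
    split=> //; rewrite eval_suml big1 // => j jJ.
    by move: tz; rewrite tE => -[_ /(_ j)]; rewrite jJ.
  rewrite tE; split; first by move: sz; rewrite sE => -[].
  move=> j; case: ifP => jJ; last exact: gs.
  move: lz; rewrite eval_suml => /eqP; rewrite psumr_eq0; last by move=> i _; apply: gs.
  by move=> /allP/(_ j); rewrite mem_index_enum jJ => /(_ isT)/eqP.
apply: subcell => [z /tP[]//|||].
- by apply/tP; split; [exact: cell0|exact: eval0].
- move=> y z /tP[sy ly] /tP[sz lz]; apply/tP; split; first exact: cellD.
  by rewrite evalD ly lz addr0.
- move=> y /tP[sy ly] z yz; apply/tP; split; first exact: cell_trans yz.
  have [e e0 eH] := flat_step (cell_flat yz).
  have : cell H p (y + (- e) *: z).
    by apply: (cell_trans sy); apply: eH; rewrite normrN gtr0_norm.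
  move=> /ls; rewrite evalD evalZ ly add0r mulNr oppr_ge0 pmulr_rle0 // => lz.
  by apply/eqP; rewrite eq_le lz ls //; apply: cell_trans yz.
Qed.

Lemma cell_face H p q : cell H p q -> is_face (cell H q) (cell H p).
Proof.
move=> pq.
(* forms vanishing at p become equations of cell H p, the others inequalities
   oriented by their sign at p; J selects those that vanish at q *)
pose f (i : 'I_(size H)) := if dual_eval H`_i p == 0 then H`_i else 0.
pose g (i : 'I_(size H)) := if dual_eval H`_i p < 0 then - H`_i else H`_i.
pose J : {set 'I_(size H)} := [set i : 'I_(size H) | dual_eval H`_i q == 0]%SET.
exists (size H), (size H), f, g, J.
have HP (P : 'cV[int]_r -> Prop) : (forall i : 'I_(size H), P H`_i) ->
    forall h, h \in H -> P h.
  move=> PH h hH.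
  by have := PH (Ordinal (etrans (index_mem h H) hH)); rewrite /= nth_index.
have Hi (i : 'I_(size H)) : H`_i \in H by rewrite mem_nth.
split; apply/seteqP; split=> z.
- move=> pz; split=> i; have [z1 z2] := pz _ (Hi i).
    rewrite /f; case: eqP => [h0|_]; last exact: eval0l.
    by apply: cell_flat pz _ (Hi i) h0.
  rewrite finset.in_set0 /g; case: ltP => h0; last exact: z1.
  by rewrite evalNl oppr_ge0 z2 // ltW.
- move=> [fz gz]; apply: HP => i; have := fz i; have := gz i.
  rewrite finset.in_set0 /f /g; case: ltgtP => h0; rewrite ?evalNl ?oppr_ge0 //.
  by move=> _ ->.
- move=> qz; have pz := cell_trans pq qz; split=> i; have [z1 z2] := pz _ (Hi i).
    rewrite /f; case: eqP => [h0|_]; last exact: eval0l.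
    by apply: cell_flat pz _ (Hi i) h0.
  have hq0 : dual_eval H`_i q = 0 -> dual_eval H`_i z = 0.
    by move=> h0; apply: cell_flat qz _ (Hi i) h0.
  rewrite finset.inE /g; case: eqP => h0; case: ltP => hp.
  + by rewrite evalNl hq0 ?oppr0.
  + by rewrite hq0.
  + by rewrite evalNl oppr_ge0 z2 // ltW.
  + exact: z1.
- move=> [fz gz]; apply: HP => i; have := fz i; have := gz i.
  have [q1 q2] := pq _ (Hi i).
  rewrite finset.inE /f /g; case: (ltgtP (dual_eval H`_i p) 0) => h0.
  + case: eqP => hq; rewrite evalNl.
      by move=> /eqP; rewrite oppr_eq0 => /eqP -> _; rewrite lexx.
    rewrite oppr_ge0 => hz _; split=> // h1; case: hq.
    by apply/eqP; rewrite eq_le h1 q2 // ltW.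
  + case: eqP => hq; first by move=> -> _; rewrite lexx.
    move=> hz _; split=> // h1; case: hq.
    by apply/eqP; rewrite eq_le h1 q1 // ltW.
  + by move=> _ ->; rewrite lexx.
Qed.

Lemma cell_is_cone H p : is_cone (cell H p).
Proof.
by have [k [m [f [g [J [E _]]]]]] := cell_face (@cell_refl H p); exists k, m, f, g.
Qed.

(** Every cone is a cell of the arrangement of its own defining forms, namely
    the cell of a generic point.  This gives cones and cells of a fixed
    arrangement a common theory of spans, faces and interiors. *)
Lemma cone_is_cell (s : set 'rV[R]_r) : is_cone s -> exists H p, s = cell H p.
Proof.
move=> [k [m [f [g sE]]]].
pose H := [seq f i | i <- enum 'I_k] ++ [seq g j | j <- enum 'I_m].
have sP z : s z <->
    (forall i, dual_eval (f i) z = 0) /\ (forall j, 0 <= dual_eval (g j) z).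
  by rewrite sE; split=> -[fz gz]; split=> // j; have := gz j; rewrite finset.in_set0.
have HP h : h \in H -> (exists i, h = f i) \/ (exists j, h = g j).
  by rewrite mem_cat => /orP[] /mapP[i _ ->]; [left|right]; exists i.
have fH i : f i \in H by rewrite mem_cat map_f ?mem_enum.
have gH j : g j \in H by rewrite mem_cat orbC map_f ?mem_enum.
have s0 : s 0 by apply/sP; split=> i; rewrite eval0.
have sD x y : s x -> s y -> s (x + y).
  move=> /sP[fx gx] /sP[fy gy]; apply/sP; split=> i; rewrite evalD ?fx ?fy ?addr0 //.
  by rewrite addr_ge0.
have [] := @generic_point s H s0 sD.
  by move=> h /HP[] [i ->]; left => z /sP[fz gz]; rewrite ?fz.
move=> p /[dup] sp /sP[fp gp] pH; exists H, p; apply/seteqP; split=> z.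
  move=> /[dup] sz /sP[fz gz] h hH; case: (HP h hH) => [] [i hE]; rewrite hE.
    by rewrite fz lexx.
  split=> // h0; rewrite -hE (pH h hH _ _ sz) // hE.
  by apply/eqP; rewrite eq_le h0 gp.
move=> pz; apply/sP; split=> i.
  by apply: cell_flat pz _ (fH i) (fp i).
by apply: (pz _ (gH i)).1.
Qed.

End Cells.

(** * Subspaces defined over the integers *)
Section RationalSubspaces.
Variable R : realType.

Lemma common_denominator (s : seq rat) : exists2 D : nat, (0 < D)%N &
  forall q, q \in s -> exists z : int, D%:R * q = z%:~R.
Proof.
elim: s => [|q s [D D0 sD]]; first by exists 1%N.
exists (`|denq q| * D)%N; first by rewrite muln_gt0 absz_gt0 denq_neq0.
have dE : (`|denq q|%N)%:R = (denq q)%:~R :> rat.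
  by rewrite -[in RHS](gez0_abs (denq_ge0 q)).
move=> q'; rewrite inE => /orP[/eqP ->|/sD[z zE]].
  exists (D%:Z * numq q).
  by rewrite natrM dE mulrAC mulrC [_%:~R * q]mulrC -numqE intrM.
by exists (denq q * z); rewrite natrM dE -mulrA zE intrM.
Qed.

Lemma rat_mx_scale (m k : nat) (Q : 'M[rat]_(m, k)) :
  exists2 D : nat, (0 < D)%N & exists B : 'M[int]_(m, k),
    extend_scalars R B = D%:R *: map_mx ratr Q.
Proof.
have [D D0 QD] := common_denominator [seq Q ij.1 ij.2 | ij <- enum {: 'I_m * 'I_k}].
exists D => //; exists (\matrix_(i, j) numq (D%:R * Q i j)).
apply/matrixP => i j; rewrite !mxE.
have [|z zE] := QD (Q i j).
  by apply/mapP; exists (i, j); rewrite ?mem_enum.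
have := congr1 (@ratr R) zE; rewrite rmorphM /= ratr_nat ratr_int => ->.
by rewrite zE numq_int.
Qed.

Lemma extend_scalars_rat (m k : nat) (B : 'M[int]_(m, k)) :
  extend_scalars R B = map_mx ratr (map_mx intr B : 'M[rat]_(m, k)).
Proof. by apply/matrixP => i j; rewrite !mxE ratr_int. Qed.

(** Kernels and row spaces can be computed over the rationals, where they have
    integral bases after clearing denominators. *)
Lemma kernel_rowspan (r k : nat) (C : 'M[int]_(r, k)) :
  exists B : 'M[int]_r, forall x : 'rV[R]_r,
    x *m extend_scalars R C = 0 <-> exists a, x = a *m extend_scalars R B.
Proof.
have [D D0 [B BE]] := rat_mx_scale (kermx (map_mx intr C : 'M[rat]_(r, k))).
have DR : D%:R != 0 :> R by rewrite pnatr_eq0 -lt0n.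
exists B => x; rewrite extend_scalars_rat BE map_kermx; split.
  move/eqP; rewrite -sub_kermx => /submxP[a ->].
  by exists (D%:R^-1 *: a); rewrite -scalemxAl -scalemxAr scalerA mulVf ?scale1r.
move=> [a ->]; rewrite -!scalemxAr -!scalemxAl -mulmxA mulmx_ker.
by rewrite mulmx0 scaler0.
Qed.

Lemma rowspan_kernel (r k : nat) (B : 'M[int]_(k, r)) :
  exists C : 'M[int]_r, forall x : 'rV[R]_r,
    x *m extend_scalars R C = 0 <-> exists a, x = a *m extend_scalars R B.
Proof.
have [D D0 [C CE]] := rat_mx_scale (cokermx (map_mx intr B : 'M[rat]_(k, r))).
have DR : D%:R != 0 :> R by rewrite pnatr_eq0 -lt0n.
exists C => x; rewrite [extend_scalars R B]extend_scalars_rat CE map_cokermx.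
rewrite -scalemxAr; split.
  move/eqP; rewrite scaler_eq0 (negPf DR) /= -submxE => /submxP[a ->].
  by exists a.
move=> [a ->]; suff /eqP -> : a *m map_mx ratr (map_mx intr B) *m
    cokermx (map_mx ratr (map_mx intr B)) == 0 by rewrite scaler0.
by rewrite -submxE submxMl.
Qed.

(** Injectivity over the reals implies injectivity over the rationals, so that
    [F] has a rational left inverse on the row space; [D] clears its
    denominators. *)
Lemma rowspan_left_inverse (k r r' : nat) (B : 'M[int]_(k, r))
    (F : 'M[int]_(r, r')) :
  (forall a : 'rV[R]_k, a *m extend_scalars R B *m extend_scalars R F = 0 ->
     a *m extend_scalars R B = 0) ->
  exists2 D : nat, (0 < D)%N & exists M : 'M[int]_(r', r),
    extend_scalars R B *m extend_scalars R F *m extend_scalars R M =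
    D%:R *: extend_scalars R B.
Proof.
move=> inj.
pose b : 'M[rat]_(k, r) := map_mx intr B; pose c : 'M[rat]_(r, r') := map_mx intr F.
have kk : (kermx (b *m c) <= kermx b)%MS.
  apply/rV_subP => a; rewrite !sub_kermx => /eqP abc.
  have := congr1 (map_mx (@ratr R)) abc; rewrite mulmxA !map_mxM -!extend_scalars_rat.
  rewrite raddf0 => /inj E; apply/eqP/(@map_mx_inj _ _ (@ratr R)).
  by rewrite map_mxM -extend_scalars_rat raddf0.
have rk : (\rank b <= \rank (b *m c))%N.
  have := mxrankS kk; rewrite !mxrank_ker.
  have := rank_leq_row b; have := rank_leq_row (b *m c).
  by lia.
have /submxP[N NE] : (b^T <= (b *m c)^T)%MS.
  by rewrite -(geq_leqif (mxrank_leqif_sup _)) ?mxrank_tr // trmx_mul submxMl.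
have [D D0 [M ME]] := rat_mx_scale N^T.
exists D => //; exists M; rewrite ME -scalemxAr; congr (_ *: _).
rewrite !extend_scalars_rat -/b -/c -!map_mxM; congr map_mx.
rewrite map_mxM -/b -/c.
by rewrite -[b *m c]trmxK -trmx_mul -NE trmxK.
Qed.

End RationalSubspaces.

(** * Indices of subgroups of a lattice *)
Lemma card_fsetM (K K' : choiceType) (A : {fset K}) (B : {fset K'}) :
  #|` (A `*` B)%fset| = (#|` A| * #|` B|)%N.
Proof.
rewrite -(size_allpairs pair); apply/perm_size/uniq_perm.
- exact: fset_uniq.
- by apply: allpairs_uniq => // -[a b] [c d] _ _ [-> ->].
move=> [a b]; rewrite in_fsetM /=; apply/andP/allpairsP => /= [[Aa Bb]|].
  by exists (a, b).
by move=> [[c d] /= [Ac Bd [-> ->]]].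
Qed.

Section Index.
Variable r : nat.
Implicit Types (A B : set 'rV[int]_r) (a b u w z : 'rV[int]_r).

Lemma mulrzE u (m : int) i j : (u *~ m) i j = u i j * m.
Proof.
case: m => n; first by rewrite -pmulrn mulmxnE -mulr_natr natz.
by rewrite NegzE mulrNz mxE -pmulrn mulmxnE -mulr_natr natz mulrN.
Qed.

Lemma mulrnE u (m : nat) i j : (u *+ m) i j = u i j * m%:Z.
Proof. by rewrite pmulrn mulrzE. Qed.

Definition subgroup A := A 0 /\ forall x y, A x -> A y -> A (x - y).

Lemma subgroupD A x y : subgroup A -> A x -> A y -> A (x + y).
Proof.
move=> [A0 AB] Ax Ay; rewrite -[y]opprK; apply: (AB _ _ Ax).
by rewrite -sub0r; apply: AB.
Qed.

Lemma subgroup_mulz A x (k : int) : subgroup A -> A x -> A (x *~ k).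
Proof.
move=> sA Ax; have [A0 AB] := sA.
have An n : A (x *+ n).
  by elim: n => [|n IH]; rewrite ?mulr0n // mulrS; apply: subgroupD.
case: k => n; first exact: An.
by rewrite NegzE mulrNz -sub0r; apply: AB => //; apply: An.
Qed.

Definition coset B a : set 'rV[int]_r := [set a + b | b in B].

Lemma coset_eq B a b : subgroup B -> coset B a = coset B b <-> B (a - b).
Proof.
move=> [B0 BB]; split=> [E|Bab].
  have : coset B a a by exists 0; rewrite ?addr0.
  by rewrite E => -[c Bc <-]; rewrite addrAC subrr add0r.
have sB : subgroup B by [].
apply/seteqP; split=> _ [c Bc <-].
  by exists (a - b + c); [exact: subgroupD|rewrite addrA subrKC].
by exists (c - (a - b)); [exact: BB|apply/rowP => j; rewrite !mxE; ring].
Qed.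

Lemma quotient_order_refl A : subgroup A -> quotient_order A A = 1%N.
Proof.
move=> sA; have [A0 AB] := sA; rewrite /quotient_order.
suff -> : quotient_set A A = [set coset A 0] by rewrite fset_set1 cardfs1.
apply/seteqP; split=> [_ [a Aa ->]|_ ->]; last by exists 0.
by apply/coset_eq; rewrite // subr0.
Qed.

(** By saturation, elements of [A] that are congruent modulo [D] differ by [D]
    times an element of [A], hence by an element of [B]. *)
Lemma finite_quotient A B (D : nat) : subgroup A -> subgroup B -> (0 < D)%N ->
  (forall z, A (z *+ D) -> A z) -> (forall z, A z -> B (z *+ D)) ->
  finite_set (quotient_set A B).
Proof.
case: D => // D sA sB _ sat DB.
pose res a : 'rV['I_D.+1]_r := \row_j inord `|(a ord0 j %% D.+1%:Z)%Z|%N.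
pose rep (t : 'rV['I_D.+1]_r) := xget 0 [set a | A a /\ res a = t].
apply: (@sub_finite_set _ _ ((coset B \o rep) @` setT)); last first.
  by apply: finite_image; apply: finite_finset.
move=> _ [a Aa ->]; exists (res a) => //=; apply/coset_eq => //.
have [Ar rr] : A (rep (res a)) /\ res (rep (res a)) = res a.
  by rewrite /rep; case: xgetP => [x _ []//|/(_ a)]; case.
set b := rep _ in Ar rr *.
have dvd j : (D.+1%:Z %| (b - a)%R ord0 j)%Z.
  rewrite !mxE -eqz_mod_dvd; move/rowP/(_ j): rr; rewrite !mxE.
  move/(congr1 val); rewrite /= !inordK //; last first.
  - by rewrite -ltz_nat gez0_abs ?modz_ge0 ?ltz_pmod.
  - by rewrite -ltz_nat gez0_abs ?modz_ge0 ?ltz_pmod.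
  move=> E; apply/eqP.
  by rewrite -[LHS]gez0_abs ?modz_ge0 // E gez0_abs ?modz_ge0.
pose c : 'rV[int]_r := \row_j ((b - a)%R ord0 j %/ D.+1%:Z)%Z.
have cE : c *+ D.+1 = b - a.
  apply/rowP => j; rewrite mulmxnE [c 0 j]mxE -[RHS](divzK (dvd j)).
  by rewrite -mulr_natr natz.
rewrite -cE; apply/DB/sat; rewrite cE; exact: sA.2.
Qed.

(** [A / A'] and [B / B'] are infinite cyclic, generated by [u] and [w], and
    [w] is [k] times [u] modulo [A'].  So [A / B] has a filtration with factors
    [A' / B'] and [Z / k]; here the cosets of [B] in [A] are listed as the
    classes of [a + i u] with [a] in a system of representatives of [A' / B']
    and [i < k]. *)
Lemma index_extend A' B' A B u w (k : nat) :
  subgroup A' -> subgroup B' -> subgroup B ->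
  (forall z, A z <-> exists m : int, A' (z - u *~ m)) ->
  (forall m : int, A' (u *~ m) -> m = 0) ->
  B' `<=` A' -> B' `<=` B -> B w ->
  (forall z, B z -> exists m : int, B' (z - w *~ m)) ->
  (0 < k)%N -> A' (w - u *+ k) ->
  finite_set (quotient_set A' B') ->
  quotient_order A B = (k * quotient_order A' B')%N.
Proof.
move=> sA' sB' sB AP u0 BA' B'B Bw BP k0 wu fin.
pose rep C := xget 0 [set a | A' a /\ C = coset B' a].
have repP C : quotient_set A' B' C -> A' (rep C) /\ C = coset B' (rep C).
  by move=> [a Aa aE]; rewrite /rep; case: xgetP => [x _ []//|/(_ a)]; case.
pose g (Ci : set 'rV[int]_r * nat) := coset B (rep Ci.1 + u *+ Ci.2).
(* if m u lies in A' + B then m u = q w modulo A', hence m = q k because u has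
   infinite order modulo A' *)
have Bmul a (m : int) : A' a -> B (a + u *~ m) ->
    exists q : int, m = q * k%:Z /\ B' (a + u *~ m - w *~ q).
  move=> Aa /BP[q Bq]; exists q; split=> //.
  apply/eqP; rewrite -subr_eq0; apply/eqP/u0.
  have -> : u *~ (m - q * k%:Z) =
      (a + u *~ m - w *~ q) - a + (w - u *+ k) *~ q.
    by apply/rowP => j; rewrite !(mulrzE, mulrnE, mxE); ring.
  apply: subgroupD => //; last exact: subgroup_mulz.
  by apply: sA'.2 => //; apply: BA'.
have gE : quotient_set A B = g @` (quotient_set A' B' `*` `I_k).
  apply/seteqP; split=> [_ [z /AP[m A'z] ->]|_ [[C i] [/= QC ik] <-]].
    pose q := (m %/ k%:Z)%Z; pose i := `|(m %% k%:Z)%Z|%N.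
    have kn0 : k%:Z != 0 by rewrite eqz_nat -lt0n.
    have mE : m = q * k%:Z + i%:Z by rewrite gez0_abs ?modz_ge0 -?divz_eq.
    pose a := z - w *~ q - u *+ i.
    have A'a : A' a.
      have -> : a = (z - u *~ m) - (w - u *+ k) *~ q.
        rewrite /a mE; by apply/rowP => j; rewrite !(mulrzE, mulrnE, mxE); ring.
      by apply: sA'.2 => //; apply: subgroup_mulz.
    have QC : quotient_set A' B' (coset B' a) by exists a.
    have [A'r rE] := repP _ QC.
    exists (coset B' a, i) => /=.
      by split=> //=; rewrite -ltz_nat gez0_abs ?modz_ge0 // ltz_pmod.
    rewrite /g /=; apply/coset_eq => //.
    have -> : rep (coset B' a) + u *+ i - z = (rep (coset B' a) - a) - w *~ q.
      rewrite /a; by apply/rowP => j; rewrite !(mulrzE, mulrnE, mxE); ring.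
    apply: sB.2; last exact: subgroup_mulz.
    by apply: B'B; apply/(coset_eq _ _ sB').
  have [A'r rE] := repP _ QC.
  exists (rep C + u *+ i) => //; apply/AP; exists i%:Z.
  by rewrite -pmulrn addrK.
have ginj : {in fset_set (quotient_set A' B' `*` `I_k) &, injective g}.
  have fX : finite_set (quotient_set A' B' `*` `I_k).
    exact: finite_setX.
  move=> [C i] [C' i']; rewrite !in_fset_set // !inE => -[/= QC ik] [/= QC' ik'].
  have [A'r rE] := repP _ QC; have [A'r' rE'] := repP _ QC'.
  rewrite /g /= => /(coset_eq _ _ sB).
  have -> : rep C + u *+ i - (rep C' + u *+ i') =
     (rep C - rep C') + u *~ (i%:Z - i'%:Z).
    by apply/rowP => j; rewrite !(mulrzE, mulrnE, mxE); ring.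
  move/(Bmul _ _ (sA'.2 _ _ A'r A'r')) => [q [qE Bq]].
  have q0 : q = 0.
    by move: qE ik ik' k0; nia.
  have ii : i = i' by move: qE; rewrite q0; lia.
  move: Bq; rewrite q0 ii subrr !mulr0z addr0 subr0 => /(coset_eq _ _ sB').
  by rewrite -rE -rE' => ->.
rewrite /quotient_order gE fset_set_image; last first.
  exact: finite_setX.
rewrite card_in_imfset //= fset_setX //.
rewrite card_fsetM mulnC; congr (_ * _)%N.
by rewrite fset_set_II card_imfset /=; [rewrite size_enum_ord|exact: val_inj].
Qed.

End Index.

Arguments cell_refl {R r} H y.
Arguments cell0 {R r} H y.

(** * Lattices of cones and primitive normal vectors *)
Section Lattices.
Variables (R : realType) (r : nat).
Implicit Types (s t : set 'rV[R]_r) (x y v : 'rV[R]_r) (H : seq 'cV[int]_r).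

Lemma cone_lattice_subgroup s : subgroup (cone_lattice s).
Proof.
split=> [|x y]; rewrite /cone_lattice /=; first by rewrite /extend_scalars raddf0 mem0v.
by rewrite extend_scalarsD extend_scalarsN => xs ys; rewrite memvB.
Qed.

Lemma cone_lattice_saturated s (z : 'rV[int]_r) (D : nat) : (0 < D)%N ->
  cone_lattice s (z *+ D) -> cone_lattice s z.
Proof.
move=> D0; rewrite /cone_lattice /= pmulrn extend_scalars_mulz => Dz.
have DR : (D%:Z%:~R : R) != 0 by rewrite intr_eq0 eqz_nat -lt0n.
by rewrite -[extend_scalars R z]scale1r -(mulVf DR) -scalerA memvZ.
Qed.

(** The span of a cone has a basis of lattice vectors. *)
Lemma lattice_detect H y (h : 'cV[int]_r) :
  (forall z, cone_lattice (cell H y) z -> dual_eval h (extend_scalars R z) = 0) ->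
  forall v, v \in cone_span (cell H y) -> dual_eval h v = 0.
Proof.
move=> h0 v /mem_cell_span/flat_mxP.
have [B BP] := kernel_rowspan R (flat_mx H y).
move=> /BP[a ->]; rewrite /dual_eval -mulmxA -extend_scalarsM.
suff -> : B *m h = 0 by rewrite /extend_scalars raddf0 mulmx0 mxE.
apply/row_matrixP => i; rewrite row_mul raddf0.
have /h0 : cone_lattice (cell H y) (row i B).
  apply/mem_cell_span/flat_mxP/BP; exists (delta_mx 0 i).
  by rewrite /extend_scalars map_row rowE.
rewrite eval_extend => /eqP; rewrite intr_eq0 => /eqP E.
by apply/rowP => j; rewrite !ord1 E mxE.
Qed.

(** A vector outside a subspace of codimension one spans a complement, giving a
    coordinate modulo [T]. *)
Lemma coord_along (T V : {vspace 'rV[R]_r}) v : (T <= V)%VS ->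
  (\dim T).+1 = \dim V -> v \in V -> v \notin T ->
  forall z, z \in V -> exists c : R, z - c *: v \in T.
Proof.
move=> TV d vV vT z zV.
have E : (T + <[v]>)%VS = V.
  have vn0 : v != 0 by apply: contraNneq vT => ->; rewrite mem0v.
  apply/eqP; rewrite eqEdim subv_add TV -memvE vV /= -d dimv_disjoint_sum.
    by rewrite dim_vline vn0 addn1.
  apply/eqP; rewrite -subv0; apply/subvP => x; rewrite memv_cap => /andP[xT].
  move=> /vlineP[k xE]; have [k0|k0] := eqVneq k 0.
    by rewrite xE k0 scale0r mem0v.
  by case/negP: vT; rewrite -[v]scale1r -(mulVf k0) -scalerA -xE memvZ.
move: zV; rewrite -E => /memv_addP[t tT [_ /vlineP[k ->] ->]].
by exists k; rewrite addrK.
Qed.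

Lemma coord_uniq (T : {vspace 'rV[R]_r}) v z (c c' : R) : v \notin T ->
  z - c *: v \in T -> z - c' *: v \in T -> c = c'.
Proof.
move=> vT zc zc'; apply/eqP; rewrite -subr_eq0; apply: contraNT vT => cc.
rewrite -[v]scale1r -(mulVf cc) -scalerA memvZ //.
have -> : (c - c') *: v = (z - c' *: v) - (z - c *: v).
  by apply/rowP => j; rewrite !mxE; ring.
exact: memvB.
Qed.

Section Facet.
Variables (H : seq 'cV[int]_r) (x y : 'rV[R]_r).
Let s := cell H x.
Let t := cell H y.
Hypothesis xy : cell H x y.
Hypothesis dim_ts : (cone_dim t).+1 = cone_dim s.

Let ts : (cone_span t <= cone_span s)%VS.
Proof. exact: cell_span_sub. Qed.

Lemma facet_point_notin : x \notin cone_span t.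
Proof.
apply/negP => /mem_cell_span fx.
have : (cone_span s <= cone_span t)%VS.
  apply/subvP => v /mem_cell_span fv; apply/mem_cell_span => h hH h0.
  by apply: fv => //; apply: fx.
by move/dimvS; rewrite -/(cone_dim s) -/(cone_dim t) -dim_ts ltnn.
Qed.

(** A form of [H] vanishing at [y] but not at [x] cuts the span of the facet
    out of the span of the cone, since the dimensions differ by one. *)
Lemma facet_form : exists h : 'cV[int]_r,
  [/\ 0 < dual_eval h x, forall v, s v -> 0 <= dual_eval h v &
      forall v, v \in cone_span s -> (v \in cone_span t) = (dual_eval h v == 0)].
Proof.
have [h [hH hy hx]] := separating_form facet_point_notin.
have xs : x \in cone_span s by exact: mem_span (cell_refl H x).
have key (h' : 'cV[int]_r) : 0 < dual_eval h' x ->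
    (forall v, v \in cone_span t -> dual_eval h' v = 0) ->
    forall v, v \in cone_span s -> (v \in cone_span t) = (dual_eval h' v == 0).
  move=> h'x h't v vs; apply/idP/eqP; first exact: h't.
  have [c vc] := coord_along ts dim_ts xs facet_point_notin vs.
  have /eqP := h't _ vc; rewrite evalD evalN evalZ => + v0.
  rewrite v0 sub0r oppr_eq0 mulf_eq0 (gt_eqF h'x) orbF => /eqP c0.
  by move: vc; rewrite c0 scale0r subr0.
have ht v : v \in cone_span t -> dual_eval h v = 0.
  by move=> /mem_cell_span; apply.
have [hx0|hx0|//] := ltgtP (dual_eval h x) 0.
  exists (- h); have hx0' : 0 < dual_eval (- h) x by rewrite evalNl oppr_gt0.
  split=> // [v /(_ h hH)[_ v2]|]; first by rewrite evalNl oppr_ge0 v2 // ltW.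
  by apply: key => // v /ht; rewrite evalNl => ->; rewrite oppr0.
exists h; split=> // [v /(_ h hH)[v1 _]|]; first by rewrite v1 // ltW.
exact: key.
Qed.

(** A lattice vector at which the form of [facet_form] takes its smallest
    positive value. *)
Lemma primitive_normal_exists : exists u, lifts_primitive_normal s t u.
Proof.
have [h [hx hs ht]] := facet_form.
pose P n := `[< exists2 u, cone_lattice s u & (0 < n)%N /\ (u *m h) 0 0 = n%:Z >].
have exP : exists n, P n.
  have [z zs hz] : exists2 z, cone_lattice s z & (z *m h) 0 0 != 0.
    apply: contrapT => no.
    suff : dual_eval h x = 0 by move: hx => /[swap] ->; rewrite ltxx.
    apply: (@lattice_detect H x) (mem_span (cell_refl H x)) => z zs.
    rewrite eval_extend; apply/eqP; rewrite intr_eq0; apply/negPn/negP => hz.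
    by apply: no; exists z.
  exists `|(z *m h)%R ord0 ord0|%N; apply/asboolP; rewrite absz_gt0 hz.
  have [h0|h0] := leP 0 ((z *m h) 0 0).
    by exists z => //; split; rewrite ?gez0_abs.
  exists (- z); last by rewrite mulNmx mxE ltz0_abs.
  by rewrite -sub0r; have [s0 sB] := cone_lattice_subgroup s; apply: sB.
case: (ex_minnP exP) => n /asboolP[u us [n0 un]] nmin.
exists u; split=> //.
  move=> v vs; exists ((v *m h)%R ord0 ord0 %/ n%:Z)%Z.
  set k := (_ %/ _)%Z.
  have [s0 sB] := cone_lattice_subgroup s.
  have ws : cone_lattice s (v - u *~ k).
    by apply: sB => //; apply: subgroup_mulz => //; apply: cone_lattice_subgroup.
  have hw : ((v - u *~ k) *m h) 0 0 = ((v *m h)%R ord0 ord0 %% n%:Z)%Z.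
    rewrite mulmxBl; have -> : (u *~ k) *m h = (u *m h) *~ k.
      by rewrite -!scaler_int -scalemxAl.
    have nz : n%:Z != 0 by rewrite eqz_nat -lt0n.
    rewrite [LHS]mxE [X in _ + X]mxE mulrzE un [X in X - _](divz_eq _ n%:Z) -/k.
    ring.
  rewrite /cone_lattice /= ht //.
  rewrite eval_extend intr_eq0 hw; apply/negPn/negP => nz.
  have nn0 : n%:Z != 0 by rewrite eqz_nat -lt0n.
  have := nmin `|((v *m h)%R ord0 ord0 %% n%:Z)%Z|%N.
  have -> : P `|((v *m h)%R ord0 ord0 %% n%:Z)%Z|%N.
    apply/asboolP; exists (v - u *~ k) => //.
    by rewrite absz_gt0 nz gez0_abs ?modz_ge0.
  move=> /(_ isT); rewrite leqNgt -ltz_nat gez0_abs ?modz_ge0 //.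
  by rewrite ltz_pmod.
exists (extend_scalars R h).
have ev v : v *m extend_scalars R h = 0 <-> dual_eval h v = 0.
  split=> [E|E]; first by rewrite /dual_eval E mxE.
  by apply/rowP => j; rewrite !ord1 [RHS]mxE.
split=> //.
- move=> v vt; apply/ev/eqP; rewrite -ht //.
  by apply: (subvP ts).
- exists x; first exact: mem_span (cell_refl H x).
  by apply/eqP => /ev; move/eqP; rewrite gt_eqF.
- by rewrite -[_ 0 0]/(dual_eval h _) eval_extend un ler0n.
Qed.

(** Any vector [v] pointing from the facet into the cone can serve as the
    coordinate direction transversal to the facet; the primitive normal vector
    is then a positive multiple of [v] modulo the facet. *)
Lemma normal_side u v z0 (e : R) : lifts_primitive_normal s t u ->
  v \in cone_span s -> v \notin cone_span t -> z0 \in cone_span t -> 0 < e ->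
  s (z0 + e *: v) ->
  exists2 c : R, 0 < c & extend_scalars R u - c *: v \in cone_span t.
Proof.
move=> [us ugen [l [lt [w ws lw] ls lu]]] vs vt z0t e0 zs.
have [c uc] := coord_along ts dim_ts vs vt us.
exists c => //; rewrite lt_neqAle eq_sym; apply/andP; split; last first.
  have [a wa] := coord_along ts dim_ts vs vt ws.
  have lv : v *m l != 0.
    apply: contraNneq lw => lv; have := lt _ wa.
    by rewrite mulmxBl -scalemxAl lv scaler0 subr0 => ->.
  have lv0 : 0 < (v *m l) 0 0.
    rewrite lt_neqAle eq_sym; apply/andP; split.
      apply: contraNneq lv => E; apply/eqP/rowP => j.
      by rewrite !ord1 E [RHS]mxE.
    have := ls _ zs; rewrite mulmxDl (lt _ z0t) add0r -scalemxAl mxE.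
    by rewrite pmulr_rge0.
  move: lu; have := lt _ uc; rewrite mulmxBl => /eqP; rewrite subr_eq0 => /eqP ->.
  by rewrite -scalemxAl mxE pmulr_lge0.
apply: contraTneq isT => c0; move: uc; rewrite c0 scale0r subr0 => ut.
have [h [hx hs ht]] := facet_form.
suff : dual_eval h x = 0 by move: hx => /[swap] ->; rewrite ltxx.
apply: (@lattice_detect H x) (mem_span (cell_refl H x)) => z zs'.
have [k zk] := ugen z zs'.
have : extend_scalars R z \in cone_span t.
  rewrite -[extend_scalars R z](subrK (extend_scalars R (u *~ k))).
  rewrite memvD //; first by rewrite -extend_scalarsN -extend_scalarsD; exact: zk.
  by rewrite extend_scalars_mulz memvZ.
by rewrite ht // => /eqP.
Qed.

End Facet.
End Lattices.

(** * Arrangements adapted to a linear map *)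
Section Images.
Variables (R : realType) (r r' : nat) (F : 'M[int]_(r, r')).
Implicit Types (s t : set 'rV[R]_r) (k : set 'rV[R]_r') (x v : 'rV[R]_r)
  (y z : 'rV[R]_r') (H : seq 'cV[int]_r) (A : seq 'cV[int]_r').

Local Notation FR := (extend_scalars R F).

Definition injective_on s := forall x, x \in cone_span s -> x *m FR = 0 -> x = 0.

Definition spans_onto s k := forall y, y \in cone_span k <->
  exists2 x, x \in cone_span s & y = x *m FR.

Lemma injective_onP s x x' : injective_on s -> x \in cone_span s ->
  x' \in cone_span s -> x *m FR = x' *m FR -> x = x'.
Proof.
move=> inj xs xs' E; apply/eqP; rewrite -subr_eq0; apply/eqP/inj.
  exact: memvB.
by rewrite mulmxBl E subrr.
Qed.

Lemma cone_left_inverse H p : injective_on (cell H p) ->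
  exists2 D : nat, (0 < D)%N & exists M : 'M[int]_(r', r),
  forall x, x \in cone_span (cell H p) -> x *m FR *m extend_scalars R M = D%:R *: x.
Proof.
move=> inj; have [B BP] := kernel_rowspan R (flat_mx H p).
have spanP x : x \in cone_span (cell H p) <-> exists a, x = a *m extend_scalars R B.
  by rewrite -BP; split=> [/mem_cell_span/flat_mxP|/flat_mxP/mem_cell_span].
have [|D D0 [M ME]] := @rowspan_left_inverse R _ _ _ B F.
  by move=> a; apply: inj; apply/spanP; exists a.
exists D => //; exists M => x /spanP[a ->].
by rewrite -!mulmxA [extend_scalars R B *m _]mulmxA ME scalemxAr.
Qed.

Lemma lattice_image_subgroup s : subgroup (lattice_image F s).
Proof.
have [s0 sB] := cone_lattice_subgroup s; split=> [|_ _ [x xs <-] [y ys <-]].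
  by exists 0; rewrite ?mul0mx.
by exists (x - y); [exact: sB|rewrite mulmxBl].
Qed.

Lemma lattice_image_sub s k :
  (forall x, x \in cone_span s -> x *m FR \in cone_span k) ->
  lattice_image F s `<=` cone_lattice k.
Proof. by move=> sk _ [z zs <-]; rewrite /cone_lattice /= extend_scalarsM sk. Qed.

(** A rational left inverse of [F] shows that the image of the lattice of the cone
    contains a multiple of the lattice of [k]. *)
Lemma finite_index H p k : injective_on (cell H p) -> spans_onto (cell H p) k ->
  finite_set (quotient_set (cone_lattice k) (lattice_image F (cell H p))).
Proof.
move=> inj onto; have [D D0 [M ME]] := cone_left_inverse inj.
apply: (finite_quotient _ _ D0).
- exact: cone_lattice_subgroup.
- exact: lattice_image_subgroup.
- by move=> z; apply: cone_lattice_saturated.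
move=> z /onto[x xs zE].
have DR : D%:R != 0 :> R by rewrite pnatr_eq0 -lt0n.
have zME : extend_scalars R (z *m M) = D%:R *: x by rewrite extend_scalarsM zE ME.
exists (z *m M); first by rewrite /cone_lattice /= zME memvZ.
apply/(@extend_scalars_inj R); rewrite extend_scalarsM zME -scalemxAl -zE.
by rewrite [z *+ D]pmulrn extend_scalars_mulz.
Qed.

(** The images of the spans of the cones of [X], and the images of the cones on
    which [F] is injective, are unions of cells of [A].  A cone on
    which [F] is not injective matters only through the dimension of its image,
    which is that of the image of its span. *)
Definition adapted (X : set (set 'rV[R]_r)) A :=
  (forall s, X s -> forall x, x \in cone_span s -> forall z, flat A (x *m FR) z ->
     exists2 x', x' \in cone_span s & z = x' *m FR) /\
  (forall s, X s -> injective_on s -> forall x, s x -> forall z,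
     cell A (x *m FR) z -> exists2 x', s x' & z = x' *m FR).

Lemma adapted_sub X A A' : {subset A <= A'} -> adapted X A -> adapted X A'.
Proof.
move=> AA' [A1 A2]; split=> s Xs.
  by move=> x xs z fz; apply: (A1 s Xs x xs) => h hA; apply/fz/AA'.
by move=> inj x sx z cz; apply: (A2 s Xs inj x sx) => h hA; apply/cz/AA'.
Qed.

(** For the span, take the integral equations of its image.  For an injective
    image, transport the forms defining [s] along an integral multiple of the
    left inverse of [F]. *)
Lemma adapted_cone s : is_cone s -> exists A, adapted [set s] A.
Proof.
move=> /cone_is_cell[H [p sE]].
have [B BP] := kernel_rowspan R (flat_mx H p).
have spanP x : x \in cone_span s <-> exists a, x = a *m extend_scalars R B.
  by rewrite -BP sE; split=> [/mem_cell_span/flat_mxP|/flat_mxP/mem_cell_span].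
have [C CP] := rowspan_kernel R (B *m F).
pose A1 := [seq col i C | i <- enum 'I_r'].
have evC i z : dual_eval (col i C) z = (z *m extend_scalars R C) 0 i.
  rewrite /dual_eval mxE [RHS]mxE; apply: eq_bigr => j _.
  by rewrite !mxE.
have A1P A : {subset A1 <= A} -> forall x, x \in cone_span s ->
    forall z, flat A (x *m FR) z -> exists2 x', x' \in cone_span s & z = x' *m FR.
  move=> A1A x /spanP[a xE] z fz.
  have /CP[b ->] : z *m extend_scalars R C = 0.
    apply/rowP => i; rewrite -evC mxE; apply: fz.
      by apply: A1A; apply: map_f; rewrite mem_enum.
    rewrite evC; have -> : x *m FR *m extend_scalars R C = 0.
      by apply/CP; exists a; rewrite xE extend_scalarsM mulmxA.
    by rewrite mxE.
  exists (b *m extend_scalars R B); first by apply/spanP; exists b.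
  by rewrite extend_scalarsM mulmxA.
have [inj|ninj] := pselect (injective_on s); last first.
  exists A1; split=> _ ->; first exact: (A1P A1).
  by move/ninj.
have [|D D0 [M ME]] := @cone_left_inverse H p; first by rewrite -sE.
exists (A1 ++ [seq M *m g | g <- H]); split=> _ ->.
  by apply: (A1P (A1 ++ _)) => h hA; rewrite mem_cat hA.
move=> _ x sx z xz.
have xs := mem_span sx.
have [|x' x's zE] := A1P _ _ x xs z (cell_flat xz).
  by move=> h hA; rewrite mem_cat hA.
exists x' => //; rewrite sE => g gH.
have DR : 0 < D%:R :> R by rewrite ltr0n.
have evM v : v \in cone_span s ->
      dual_eval (M *m g) (v *m FR) = D%:R * dual_eval g v.
  by rewrite sE => vs; rewrite eval_mulmx ME // evalZ.
have [] := xz (M *m g); first by rewrite mem_cat map_f ?orbT.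
rewrite zE !evM // !pmulr_rge0 // !pmulr_rle0 // => z1 z2.
have [x1 x2] : (0 <= dual_eval g p -> 0 <= dual_eval g x) /\
   (dual_eval g p <= 0 -> dual_eval g x <= 0) by move: sx; rewrite sE; apply.
by split=> [/x1/z1|/x2/z2].
Qed.

Lemma adapted_exists X : finite_set X -> (forall s, X s -> is_cone s) ->
  exists A, adapted X A.
Proof.
move=> /finite_fsetP[S SE] cX.
have /choice[a aP] s : exists A, X s -> adapted [set s] A.
  have [/cX/adapted_cone[A AP]|nX] := pselect (X s); first by exists A.
  by exists [::].
exists (flatten [seq a s | s <- enum_fset S]).
have sub s : X s -> {subset a s <= flatten [seq a s | s <- enum_fset S]}.
  move=> Xs h hs; apply/flatten_mapP; exists s => //.
  by move: Xs; rewrite SE.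
split=> s /[dup] Xs /aP /(adapted_sub (sub s Xs))[A1 A2]; [exact: A1|exact: A2].
Qed.

End Images.

Lemma normal_notin (R : realType) (r : nat) (H : seq 'cV[int]_r)
    (p q : 'rV[R]_r) u : cell H p q ->
  (cone_dim (cell H q)).+1 = cone_dim (cell H p) ->
  lifts_primitive_normal (cell H p) (cell H q) u ->
  extend_scalars R u \notin cone_span (cell H q).
Proof.
move=> pq d lu; have pn := facet_point_notin d.
have s1 : cell H p (0 + 1 *: p) by rewrite scale1r add0r; apply: cell_refl.
have [c c0 uc] := normal_side pq d lu (mem_span (cell_refl H p)) pn (mem0v _)
  ltr01 s1.
apply: contra pn => us; rewrite -[p]scale1r -(mulVf (lt0r_neq0 c0)) -scalerA memvZ //.
by rewrite -[c *: p](subKr (extend_scalars R u)) memvB.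
Qed.

Section FacetIndex.
Variables (R : realType) (r r' : nat) (F : 'M[int]_(r, r')).
Variables (H : seq 'cV[int]_r) (p q : 'rV[R]_r).
Variables (A : seq 'cV[int]_r') (x y : 'rV[R]_r').

(** [F] is injective on the span of [cell H p], so the part of the image
    lattice that lies in the span of [cell A y] is the image of the lattice of
    the facet; this is what [index_extend] needs. *)
Lemma index_facet (w : 'rV[int]_r) (u : 'rV[int]_r') (k : nat) :
  cell H p q -> cell A x y ->
  (cone_dim (cell H q)).+1 = cone_dim (cell H p) ->
  (cone_dim (cell A y)).+1 = cone_dim (cell A x) ->
  injective_on F (cell H p) ->
  spans_onto F (cell H p) (cell A x) -> spans_onto F (cell H q) (cell A y) ->
  lifts_primitive_normal (cell H p) (cell H q) w ->
  lifts_primitive_normal (cell A x) (cell A y) u ->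
  (0 < k)%N -> cone_lattice (cell A y) (w *m F - u *+ k) ->
  quotient_order (cone_lattice (cell A x)) (lattice_image F (cell H p)) =
  (k * quotient_order (cone_lattice (cell A y)) (lattice_image F (cell H q)))%N.
Proof.
move=> pq xy dq dy inj onto onto' lw lu k0 wk.
have [ux ugen _] := lu; have [wp wgen _] := lw.
have sx := cone_lattice_subgroup (cell A x).
have sy := cone_lattice_subgroup (cell A y).
have yx : cone_lattice (cell A y) `<=` cone_lattice (cell A x).
  by move=> z; apply: (subvP (cell_span_sub xy)).
have qp : cone_lattice (cell H q) `<=` cone_lattice (cell H p).
  by move=> z; apply: (subvP (cell_span_sub pq)).
have inj' : injective_on F (cell H q).
  by move=> z /(subvP (cell_span_sub pq)); apply: inj.
apply: (index_extend (u := u) (w := w *m F)) => //.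
- exact: lattice_image_subgroup.
- exact: lattice_image_subgroup.
- move=> z; split=> [/ugen//|[m zm]].
  by rewrite -[z](subrK (u *~ m)); apply: subgroupD => //;
     [exact: yx|exact: subgroup_mulz].
- move=> m um; apply/eqP; apply: contraT => m0.
  have /negP[] := normal_notin xy dy lu.
  apply: (@cone_lattice_saturated _ _ _ _ `|m|%N); first by rewrite absz_gt0.
  case: m um {m0} => m um; first by rewrite pmulrn.
  rewrite NegzE in um *; rewrite abszN /= pmulrn -[_ *~ _]opprK -mulrNz.
  by rewrite -sub0r; apply: sy.2 => //; exact: sy.1.
- by apply: lattice_image_sub => z zq; apply/onto'; exists z.
- by move=> _ [z zq <-]; exists z => //; exact: qp.
- by exists w.
- move=> _ [z zp <-]; have [m zm] := wgen z zp; exists m.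
  by exists (z - w *~ m) => //; rewrite mulmxBl -!scaler_int -scalemxAl.
- exact: finite_index.
Qed.

End FacetIndex.

(** * The cells around a cell of codimension one *)
Section Sides.
Variables (R : realType) (r : nat) (A : seq 'cV[int]_r).
Implicit Types (x y z v : 'rV[R]_r).

(** A cell is determined by the signs of the forms at its interior points. *)
Lemma finite_cells : finite_set [set k : set 'rV[R]_r | exists x, k = cell A x].
Proof.
pose g (t : (size A).-tuple (bool * bool)) : set 'rV[R]_r :=
  [set z | forall i : 'I_(size A), ((tnth t i).1 -> 0 <= dual_eval A`_i z) /\
                                   ((tnth t i).2 -> dual_eval A`_i z <= 0)].
apply: (@sub_finite_set _ _ (g @` setT)); last first.
  by apply: finite_image; apply: finite_finset.
move=> _ [x ->].
exists [tuple (0 <= dual_eval A`_i x, dual_eval A`_i x <= 0) | i < size A] => //.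
apply/seteqP; split=> z gz => [h hA|i]; last first.
  by rewrite !tnth_mktuple /=; apply: gz; rewrite mem_nth.
have := gz (Ordinal (etrans (index_mem h A) hA)).
by rewrite !tnth_mktuple /= nth_index.
Qed.

Lemma mem_span_dim x y : x \in cone_span (cell A y) ->
  (cone_dim (cell A x) <= cone_dim (cell A y))%N.
Proof.
move=> /mem_cell_span fx; apply/dimvS/subvP => v /mem_cell_span fv.
by apply/mem_cell_span => h hA h0; apply: fv => //; apply: fx.
Qed.

(** Moving from [y] a little in the direction [v] enters a cell that spans [W]:
    the forms that vanish at the new point vanish at [v] and on the span of the
    cell of [y]. *)
Lemma side_cell y v (W : {vspace 'rV[R]_r}) :
  (cone_span (cell A y) <= W)%VS -> (cone_dim (cell A y)).+1 = \dim W ->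
  (forall x, x \in W -> forall z, flat A x z -> z \in W) ->
  v \in W -> v \notin cone_span (cell A y) ->
  exists2 e : R, 0 < e & forall t, 0 < t -> t <= e ->
    cell A (y + t *: v) y /\ cone_span (cell A (y + t *: v)) = W.
Proof.
move=> yW d WA vW vy; have [e e0 eH] := small_step A y v.
exists e => // t t0 te.
have {eH} tH h : h \in A -> (0 < dual_eval h y -> 0 < dual_eval h (y + t *: v)) /\
    (dual_eval h y < 0 -> dual_eval h (y + t *: v) < 0).
  by move=> hA; apply: eH => //; rewrite gtr0_norm.
split.
  move=> h hA; have [p1 p2] := tH h hA.
  by case: (ltgtP (dual_eval h y) 0) => // h0; split=> //;
     rewrite leNgt ?p1 ?p2.
have ys : y \in cone_span (cell A y) by exact: mem_span (cell_refl A y).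
apply/eqP; rewrite eqEsubv; apply/andP; split; apply/subvP => z.
  by move/mem_cell_span; apply: WA; rewrite memvD ?memvZ // (subvP yW).
move=> zW; apply/mem_cell_span => h hA hyv.
have [p1 p2] := tH h hA.
have hy : dual_eval h y = 0.
  by have [/p2|/p1|//] := ltgtP (dual_eval h y) 0; rewrite hyv ltxx.
have hv : dual_eval h v = 0.
  move: hyv; rewrite evalD evalZ hy add0r => /eqP.
  by rewrite mulf_eq0 (gt_eqF t0) => /eqP.
have [c zc] := coord_along yW d vW vy zW.
have := (mem_cell_span A y (z - c *: v)).1 zc h hA hy.
by rewrite evalD evalN evalZ hv mulr0 subr0.
Qed.

(** Forms not vanishing at [y] have the same sign on all cells around [y]; the
    others vanish on the span of the cell of [y], so their signs at [x] and [x']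
    are those at [v]. *)
Lemma side_unique y v x x' (c c' : R) :
  0 < c -> x - c *: v \in cone_span (cell A y) -> cell A x y ->
  0 < c' -> x' - c' *: v \in cone_span (cell A y) -> cell A x' y ->
  cell A x = cell A x'.
Proof.
have half x1 x2 (c1 c2 : R) :
    0 < c1 -> x1 - c1 *: v \in cone_span (cell A y) -> cell A x1 y ->
    0 < c2 -> x2 - c2 *: v \in cone_span (cell A y) -> cell A x2 y ->
    cell A x1 `<=` cell A x2.
  move=> c10 /mem_cell_span x1v x1y c20 /mem_cell_span x2v x2y.
  apply: sub_cell => h hA; have [a1 a2] := x1y h hA; have [b1 b2] := x2y h hA.
  have [h0|h0|h0] := ltgtP (dual_eval h y) 0.
  - split=> [/b1|_]; first by rewrite leNgt h0.
    by rewrite leNgt; apply/negP => /ltW/a1; rewrite leNgt h0.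
  - split=> [_|/b2]; last by rewrite leNgt h0.
    by rewrite leNgt; apply/negP => /ltW/a2; rewrite leNgt h0.
  have := x1v h hA h0; have := x2v h hA h0; rewrite !evalD !evalN !evalZ.
  move=> /eqP; rewrite subr_eq0 => /eqP -> /eqP; rewrite subr_eq0 => /eqP ->.
  by rewrite !pmulr_rge0 // !pmulr_rle0.
by move=> *; apply/seteqP; split; [apply: (half x x' c c')|apply: (half x' x c' c)].
Qed.

(** Both normal vectors generate the same infinite cyclic quotient of lattices
    and lie on different sides of the span of the cell of [y]. *)
Lemma opposite_normals y v (e : R) u u' : 0 < e ->
  cell A (y + e *: v) y -> cell A (y + e *: - v) y ->
  cone_span (cell A (y + e *: v)) = cone_span (cell A (y + e *: - v)) ->
  (cone_dim (cell A y)).+1 = cone_dim (cell A (y + e *: v)) ->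
  v \in cone_span (cell A (y + e *: v)) -> v \notin cone_span (cell A y) ->
  lifts_primitive_normal (cell A (y + e *: v)) (cell A y) u ->
  lifts_primitive_normal (cell A (y + e *: - v)) (cell A y) u' ->
  extend_scalars R u + extend_scalars R u' \in cone_span (cell A y).
Proof.
move=> e0 yp ym spE d vs vy lu lu'.
have ys : y \in cone_span (cell A y) by exact: mem_span (cell_refl A y).
have d' : (cone_dim (cell A y)).+1 = cone_dim (cell A (y + e *: - v)).
  by rewrite d /cone_dim spE.
have [c c0 uc] := normal_side yp d lu vs vy ys e0 (cell_refl _ _).
have [|| c' c'0 uc'] := normal_side ym d' lu' _ _ ys e0 (cell_refl _ _).
- by rewrite -spE memvN.
- by rewrite memvN.
have [u1 ugen _] := lu; have [u'1 ugen' _] := lu'.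
have [k uk] : exists k, cone_lattice (cell A y) (u' - u *~ k).
  by apply: ugen; rewrite /cone_lattice /= spE.
have [k' uk'] : exists k, cone_lattice (cell A y) (u - u' *~ k).
  by apply: ugen'; rewrite /cone_lattice /= -spE.
move: uk uk'; rewrite /cone_lattice /= !extend_scalarsD !extend_scalarsN.
rewrite !extend_scalars_mulz => uk uk'.
have E1 : - c' = k%:~R * c.
  apply: (coord_uniq vy (z := extend_scalars R u')).
    by rewrite scaleNr -scalerN.
  have -> : extend_scalars R u' - (k%:~R * c) *: v =
     (extend_scalars R u' - k%:~R *: extend_scalars R u) +
     k%:~R *: (extend_scalars R u - c *: v) by apply/rowP => j; rewrite !mxE; ring.
  by rewrite memvD ?memvZ.
have E2 : c = - (k'%:~R * c').
  apply: (coord_uniq vy uc).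
  have -> : extend_scalars R u - - (k'%:~R * c') *: v =
     (extend_scalars R u - k'%:~R *: extend_scalars R u') +
     k'%:~R *: (extend_scalars R u' - c' *: - v) by apply/rowP => j; rewrite !mxE; ring.
  by rewrite memvD ?memvZ.
have kk : k * k' = 1.
  apply/eqP; rewrite -(eqr_int R) intrM.
  rewrite -(inj_eq (mulIf (lt0r_neq0 c0))) mul1r.
  by apply/eqP; rewrite mulrAC -E1 [RHS]E2; ring.
have k0 : k < 0.
  by rewrite -(ltrz0 R) -(pmulr_llt0 _ c0) -E1 oppr_lt0.
have k1 : k = - 1.
  have k'0 : k' < 0 by nia.
  by nia.
have cc : c = c' by move: E1; rewrite k1; lra.
have -> : extend_scalars R u + extend_scalars R u' =
  (extend_scalars R u - c *: v) + (extend_scalars R u' - c' *: - v).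
  by rewrite cc; apply/rowP => j; rewrite !mxE; ring.
exact: memvD.
Qed.

End Sides.

Lemma primitive_normalP (R : realType) (r : nat) (H : seq 'cV[int]_r)
    (x y : 'rV[R]_r) : cell H x y ->
  (cone_dim (cell H y)).+1 = cone_dim (cell H x) ->
  lifts_primitive_normal (cell H x) (cell H y)
    (primitive_normal (cell H x) (cell H y)).
Proof.
move=> xy d; rewrite /primitive_normal; case: xgetP => [u -> //|no].
by have [u /no] := primitive_normal_exists xy d.
Qed.

(** * The push-forward of the weights and its balancing *)
Section PushForward.
Variables (R : realType) (r r' n : nat) (X : set (set 'rV[R]_r)).
Variables (F : 'M[int]_(r, r')) (A : seq 'cV[int]_r').
Implicit Types (s t : set 'rV[R]_r) (k : set 'rV[R]_r') (p q : 'rV[R]_r)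
  (x y z v : 'rV[R]_r').

Local Notation FR := (extend_scalars R F).

Definition cone_image s : set 'rV[R]_r' := [set p *m FR | p in s].

Definition lattice_index s k : nat :=
  quotient_order (cone_lattice k) (lattice_image F s).

Definition pushforward_weight (w : set 'rV[R]_r -> int) k : int :=
  \sum_(s \in fan_cones X n `&` [set s | k `<=` cone_image s])
    w s * (lattice_index s k)%:Z.

Definition star y : set (set 'rV[R]_r') :=
  [set k | (exists x, k = cell A x) /\ cone_dim k = n /\ k y].

Definition facets_over y : set (set 'rV[R]_r) :=
  [set t | [/\ X t, (cone_dim t).+1 = n & cone_image t y]].

Hypothesis fanX : is_fan X.
Hypothesis dimX : forall s, X s -> (cone_dim s <= n)%N.
Hypothesis adX : adapted F X A.

Lemma image_span s : exists W : {vspace 'rV[R]_r'},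
  [/\ forall z, z \in W <-> exists2 p, p \in cone_span s & z = p *m FR,
      (\dim W <= cone_dim s)%N & \dim W = cone_dim s <-> injective_on F s].
Proof.
pose phi := linfun (mulmxr FR : {linear 'rV[R]_r -> 'rV[R]_r'}).
have phiE p : phi p = p *m FR by rewrite lfunE.
exists (phi @: cone_span s)%VS; have dE := limg_ker_dim phi (cone_span s).
split=> [z||].
- by split=> [/memv_imgP[p ps ->]|[p ps ->]]; [exists p|rewrite -phiE memv_img].
- by rewrite /cone_dim -dE leq_addl.
split=> [d p ps p0|inj].
  have /eqP : \dim (cone_span s :&: lker phi)%VS = 0%N 
    by move/eqP: dE; rewrite -/(cone_dim s) -d -[X in _ == X]add0n eqn_add2r => /eqP.
  rewrite dimv_eq0 => /eqP E; apply/eqP; rewrite -memv0 -E memv_cap ps memv_ker.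
  by rewrite phiE p0 /=.
rewrite /cone_dim -dE; suff -> : (cone_span s :&: lker phi)%VS = 0%VS by rewrite dimv0.
apply/eqP; rewrite -subv0; apply/subvP => p; rewrite memv_cap => /andP[ps].
by rewrite memv_ker phiE memv0 => /eqP /(inj p ps) ->.
Qed.

Lemma fan_cell H p q : X (cell H p) -> cell H p q -> X (cell H q).
Proof.
by move=> Xp pq; have [_ _ Xf _] := fanX; apply: Xf Xp (cell_face pq).
Qed.

Lemma adapted_span s p : X s -> p \in cone_span s ->
  exists2 W : {vspace 'rV[R]_r'},
    (forall z, z \in W <-> exists2 p, p \in cone_span s & z = p *m FR) &
    [/\ (cone_span (cell A (p *m FR)) <= W)%VS, (\dim W <= cone_dim s)%N,
        \dim W = cone_dim s <-> injective_on F s &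
        forall x, x \in W -> forall z, flat A x z -> z \in W].
Proof.
move=> Xs ps; have [W [WP dW inj]] := image_span s.
have WA x : x \in W -> forall z, flat A x z -> z \in W.
  by move=> /WP[q qs ->] z fz; apply/WP; apply: adX.1 fz.
exists W => //; split=> //; apply/subvP => z /mem_cell_span; apply: WA.
by apply/WP; exists p.
Qed.

(** A cone of dimension at most [n] whose image contains an [n]-dimensional set
    has no room for a kernel. *)
Lemma image_inj s k : k `<=` cone_image s -> cone_dim k = n -> X s ->
  injective_on F s /\ spans_onto F s k /\ cone_dim s = n.
Proof.
move=> ks dk Xs; have [W [WP dW inj]] := image_span s.
have kW : (cone_span k <= W)%VS.
  have [_] := cone_spanP k; apply => x /ks[p sp <-] /=.
  by apply/WP; exists p => //; exact: mem_span.
have dnW : (n <= \dim W)%N by rewrite -dk dimvS.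
have ds := dimX Xs.
have E : cone_span k = W by apply/eqP; rewrite eqEdim kW -/(cone_dim k) dk; lia.
split; first by apply/inj; lia.
split; last by lia.
by move=> z; rewrite E; exact: WP.
Qed.

Lemma adapted_image s p : X s -> injective_on F s -> s p ->
  cell A (p *m FR) `<=` cone_image s.
Proof. by move=> Xs inj sp z /(adX.2 s Xs inj p sp)[q sq ->]; exists q. Qed.

(** The contribution of a single cone [s] to the balancing condition at [y].
    The second sum has at most one term, for the facet of [s] over [y]. *)
Lemma local_balance s y : fan_cones X n s -> (cone_dim (cell A y)).+1 = n ->
  \sum_(k \in star y `&` [set k | k `<=` cone_image s])
     (lattice_index s k)%:R *: extend_scalars R (primitive_normal k (cell A y))
  - \sum_(t \in facets_over y `&` [set t | is_proper_face t s])
     (lattice_index t (cell A y))%:R *: (extend_scalars R (primitive_normal s t) *m FR)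
  \in cone_span (cell A y).
Proof.
move=> [Xs ds] dy; have [finX coneX faceX interX] := fanX.
set T := cone_span (cell A y).
have yT : y \in T by exact: mem_span (cell_refl A y).
have [H [p sE]] := cone_is_cell (coneX _ Xs).
have [[P sP PF]|noP] := pselect (cone_image s y); last first.
  rewrite [X in X - _](_ : _ = 0) ?[X in _ - X](_ : _ = 0) ?subr0 ?mem0v //.
    rewrite (_ : _ `&` _ = set0) ?fsbig_set0 // -subset0 => t.
    move=> [[Xt dt [P tP Py]] [+ _]]; rewrite sE => /face_cell[q pq tE].
    by case: noP; exists P => //; rewrite sE; apply: (sub_cell pq); rewrite -tE.
  rewrite (_ : _ `&` _ = set0) ?fsbig_set0 // -subset0 => k [[_ [_ ky]] ks].
  by case: noP; exact: ks.
have Ps := mem_span sP.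
have [W WP] := adapted_span Xs Ps; rewrite PF -/T => -[TW dW injW WA].
have [inj|ninj] := pselect (injective_on F s); last first.
  (* the image of the span of s has dimension less than n but contains T, so it
     is T: no cell of dimension n fits in, and the normals of s map into T *)
  rewrite [X in X - _](_ : _ = 0); last first.
    rewrite (_ : _ `&` _ = set0) ?fsbig_set0 // -subset0 => k [[_ [dk _]] /= ks].
    by case: ninj; have [] := image_inj ks dk Xs.
  rewrite sub0r memvN.
  have TE : T = W.
    apply/eqP; rewrite eqEdim TW /=; have ndW : \dim W <> n by rewrite -ds => /injW.
    by move: dW ndW; rewrite ds -[\dim T]/(cone_dim (cell A y)); lia.
  rewrite fsbig_finite; last first.
    by apply: finite_setIl; apply: sub_finite_set finX => t [].
  rewrite memv_suml // => t _; rewrite memvZ // TE; apply/WP.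
  exists (extend_scalars R (primitive_normal s t)) => //.
  rewrite /primitive_normal; case: xgetP => [u -> []//|_].
  by rewrite /extend_scalars raddf0 mem0v.
have dWn : \dim W = n by rewrite -ds; apply/injW.
have dTW : (\dim T).+1 = \dim W by rewrite dWn.
pose m := cell H P.
have pP : cell H p P by move: sP; rewrite sE.
have Xm : X m by apply: fan_cell pP; rewrite -sE.
have mP : m P by exact: cell_refl.
have ms : m `<=` s by rewrite sE; exact: sub_cell.
have [W0 W0P] := adapted_span Xm (mem_span mP); rewrite PF -/T => -[TW0 dW0 _ _].
have dm : (n <= (cone_dim m).+1)%N.
  by have := dimvS TW0; rewrite -/(cone_dim (cell A y)); lia.
have unique_P q : s q -> q *m FR = y -> q = P.
  by move=> sq qy; apply: (injective_onP inj) => //; rewrite ?mem_span // qy.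
(* the side of T on which a cell of the star lies is the sign of the
     coordinate c along any direction v transversal to T *)
have star_coord k v : star y k -> k `<=` cone_image s -> v \in W -> v \notin T ->
    exists x (c : R), [/\ k = cell A x, cell A x y, x - c *: v \in T, c != 0 &
      exists2 q, s q & q *m FR = x].
  move=> [[x kE] [dk ky]] ks vW vT.
  have [q sq qx] : cone_image s x by apply: ks; rewrite kE; exact: cell_refl.
  have xW : x \in W by apply/WP; exists q => //; exact: mem_span.
  have [c xc] := coord_along TW dTW vW vT xW.
  exists x, c; split=> //; [by rewrite -kE| |by exists q].
  apply/eqP => c0; move: xc; rewrite c0 scale0r subr0 => /mem_span_dim.
  by rewrite -kE dk -dy ltnn.
have star_side v e : 0 < e -> cell A (y + e *: v) y ->
    cone_span (cell A (y + e *: v)) = W -> cone_image s (y + e *: v) ->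
    (star y `&` [set k | k `<=` cone_image s]) (cell A (y + e *: v)).
  move=> e0 cy cW [q sq qE]; split; last by rewrite /= -qE; apply: adapted_image.
  by split; [exists (y + e *: v)|rewrite /cone_dim cW].
have [dmn|dmn] : cone_dim m = n \/ (cone_dim m).+1 = n.
  by have := dimX Xm; lia.
- (* y is the image of an interior point of s: both sides of T stay in the image,
     and the two normal vectors cancel *)
  have mE : m = s by rewrite /m sE; apply: cell_eq pP _; rewrite -sE ds -/m dmn.
  rewrite [X in _ - X](_ : _ = 0); last first.
    rewrite (_ : _ `&` _ = set0) ?fsbig_set0 // -subset0 => t.
    move=> [[Xt dt [Q tQ QF]] [+ _]]; rewrite sE => /face_cell[q pq tE].
    have QP : Q = P.
      by apply: unique_P => //; rewrite sE; apply: (sub_cell pq); rewrite -tE.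
    have qP : cell H q P by rewrite -tE -QP.
    by have := cone_dim_mono (sub_cell qP); rewrite -/m dmn -tE -dt ltnn.
  rewrite subr0.
  have [v vW vT] : exists2 v, v \in W & v \notin T.
    apply: contrapT => no; have : (W <= T)%VS.
      by apply/subvP => v vW; apply: contrapT => /negP vT; apply: no; exists v.
    by move/dimvS; rewrite -dTW ltnn.
  have [V Vs vE] := (WP v).1 vW.
  have [e1 e10 e1H] : exists2 e : R, 0 < e &
      forall a : R, `|a| <= e -> cell H P (P + a *: V).
    by apply: flat_step; apply/mem_cell_span; rewrite -/m mE.
  have vT' : - v \notin T by rewrite memvN.
  have vW' : - v \in W by rewrite memvN.
  have [e2 e20 e2H] := side_cell TW dTW WA vW vT.
  have [e3 e30 e3H] := side_cell TW dTW WA vW' vT'.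
  pose e := Num.min e1 (Num.min e2 e3).
  have e0 : 0 < e by rewrite !lt_min e10 e20.
  have [yp sp] : cell A (y + e *: v) y /\ cone_span (cell A (y + e *: v)) = W.
    by apply: e2H => //; rewrite /e !ge_min lexx orbT.
  have [ym sm] : cell A (y + e *: - v) y /\ cone_span (cell A (y + e *: - v)) = W.
    by apply: e3H => //; rewrite /e !ge_min lexx !orbT.
  have ip : cone_image s (y + e *: v).
    exists (P + e *: V); last by rewrite mulmxDl PF -scalemxAl -vE.
    by rewrite -mE; apply: e1H; rewrite gtr0_norm // /e ge_min lexx.
  have im : cone_image s (y + e *: - v).
    exists (P + (- e) *: V); last first.
      by rewrite mulmxDl PF -scalemxAl -vE scaleNr scalerN.
    by rewrite -mE; apply: e1H; rewrite normrN gtr0_norm // /e ge_min lexx.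
  have Sp := star_side _ _ e0 yp sp ip; have Sm := star_side _ _ e0 ym sm im.
  have -> : star y `&` [set k | k `<=` cone_image s] =
      [set cell A (y + e *: v)] `|` [set cell A (y + e *: - v)].
    apply/seteqP; split=> [k [ky ks]|k [->|->]//].
    have [x [c [kE xy xc cn0 _]]] := star_coord k v ky ks vW vT.
    have [c0|c0] := ltP 0 c; [left|right]; rewrite /= kE.
      apply: (side_unique c0 xc xy e0 _ yp).
      by rewrite addrK.
    apply: (side_unique (v := - v) (c := - c) (c' := e) _ _ xy e0 _ ym).
    - by rewrite oppr_gt0 lt_neqAle cn0.
    - by rewrite scalerN scaleNr opprK.
    - by rewrite addrK.
  have [h [hA hy hv]] := separating_form vT.
  rewrite fsbigU0; [|exact: finite_set1|exact: finite_set1|]; last first.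
    move=> k [-> /= E]; have := cell_refl A (y + e *: v); rewrite E => /(_ h hA).
    rewrite !evalD !evalZ evalN hy !add0r mulrN oppr_ge0 oppr_le0.
    rewrite !pmulr_rge0 // !pmulr_rle0 // => -[E1 E2]; case: hv; apply/eqP.
    have [v0|v0] := leP 0 (dual_eval h v).
      by rewrite eq_le v0 E2.
    by move: (v0); rewrite ltNge E1 // ltW.
  rewrite !fsbig_set1.
  have -> : lattice_index s (cell A (y + e *: - v)) =
      lattice_index s (cell A (y + e *: v)).
    by rewrite /lattice_index /cone_lattice sp sm.
  have dp : (cone_dim (cell A y)).+1 = cone_dim (cell A (y + e *: v)).
    by rewrite /cone_dim sp.
  have dq : (cone_dim (cell A y)).+1 = cone_dim (cell A (y + e *: - v)).
    by rewrite /cone_dim sm.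
  have vp : v \in cone_span (cell A (y + e *: v)) by rewrite sp.
  have := opposite_normals e0 yp ym (etrans sp (esym sm)) dp vp vT
    (primitive_normalP yp dp) (primitive_normalP ym dq).
  move=> /(memvZ (lattice_index s (cell A (y + e *: v)))%:R).
  by rewrite scalerDr.
- (* y is the image of an interior point of a facet m of s: the interior point p
     of s gives the direction v = p F, and only its side of T is in the image *)
  have dms : (cone_dim m).+1 = cone_dim (cell H p) by rewrite -sE ds.
  have pm : p \notin cone_span m by exact: facet_point_notin dms.
  have sp : s p by rewrite sE; exact: cell_refl.
  have ps := mem_span sp.
  have mspan q : q \in cone_span m -> q \in cone_span s.
    by apply/subvP/cone_span_mono.
  (* the image of the span of m has dimension at most n - 1 = dim T *)
  have TE : T = W0 by apply/eqP; rewrite eqEdim TW0 -/(cone_dim (cell A y)); lia.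
  have -> : facets_over y `&` [set t | is_proper_face t s] = [set m].
    apply/seteqP; split=> [t|_ ->].
      move=> [[Xt dt [Q tQ QF]] [+ _]]; rewrite sE => /face_cell[q pq tE].
      have QP : Q = P.
        by apply: unique_P => //; rewrite sE; apply: (sub_cell pq); rewrite -tE.
      rewrite tE; apply/esym/cell_eq; first by rewrite -tE -QP.
      by rewrite -tE -/m; lia.
    split; first by split=> //; exists P.
    split; first by rewrite sE; exact: cell_face.
    by move=> E; move: dmn; rewrite E ds; lia.
  pose v := p *m FR.
  have vW : v \in W by apply/WP; exists p.
  have vT : v \notin T.
    apply: contra pm; rewrite TE => /W0P[z zm pz].
    by rewrite (injective_onP inj ps (mspan _ zm) pz).
  have [e e0 /(_ e e0 (lexx e)) [yp spW]] := side_cell TW dTW WA vW vT.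
  have ip : cone_image s (y + e *: v).
    exists (P + e *: p); last by rewrite mulmxDl PF -scalemxAl.
    move: sP sp; rewrite sE => sP sp.
    by apply: cellD => //; apply: cellZ => //; exact: ltW.
  have Sp := star_side _ _ e0 yp spW ip.
  have -> : star y `&` [set k | k `<=` cone_image s] = [set cell A (y + e *: v)].
    apply/seteqP; split=> [k [ky ks]|k ->//].
    have [x [c [kE xy xc cn0 [q sq qx]]]] := star_coord k v ky ks vW vT.
    rewrite /= kE; apply: (side_unique _ xc xy e0 _ yp); last by rewrite addrK.
    rewrite lt_neqAle eq_sym cn0 /=.
    have [h [hH hP hp]] := separating_form pm.
    have qc : q - c *: p \in cone_span m.
      move: xc; rewrite -qx /v scalemxAl -mulmxBl TE => /W0P[z zm zE].
      rewrite (injective_onP inj _ (mspan _ zm) zE) //.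
      by rewrite memvB ?memvZ // mem_span.
    have := (mem_cell_span H P (q - c *: p)).1 qc h hH hP.
    rewrite evalD evalN evalZ => /eqP; rewrite subr_eq0 => /eqP qE.
    have [q1 q2] : (0 <= dual_eval h p -> 0 <= dual_eval h q) /\
                   (dual_eval h p <= 0 -> dual_eval h q <= 0).
      by move: sq; rewrite sE; apply.
    have [p0|p0|//] := ltgtP (dual_eval h p) 0.
      by have := q2 (ltW p0); rewrite qE nmulr_lle0.
    by have := q1 (ltW p0); rewrite qE pmulr_lge0.
  rewrite !fsbig_set1.
  have ln : lifts_primitive_normal s m (primitive_normal s m).
    by rewrite sE; apply: primitive_normalP.
  have dk : (cone_dim (cell A y)).+1 = cone_dim (cell A (y + e *: v)).
    by rewrite /cone_dim spW.
  have lk := primitive_normalP yp dk.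
  set U := primitive_normal s m in ln *; set u := primitive_normal _ _ in lk *.
  have [Us _ _] := ln.
  have [c c0 Uc] : exists2 c : R, 0 < c & extend_scalars R U - c *: p \in cone_span m.
    rewrite sE in ln sp ps; apply: (normal_side pP dms ln ps pm (mem0v _) ltr01).
    by rewrite add0r scale1r.
  have UcF : extend_scalars R (U *m F) - c *: v \in T.
    rewrite extend_scalarsM /v scalemxAl -mulmxBl TE; apply/W0P.
    by eexists; first exact: Uc.
  have [c' c'0 uc] : exists2 c : R, 0 < c & extend_scalars R u - c *: v \in T.
    apply: (normal_side yp dk lk _ vT yT e0 (cell_refl _ _)); by rewrite spW.
  have [u1 ugen _] := lk.
  have [k Uk] : exists k : int, cone_lattice (cell A y) (U *m F - u *~ k).
    apply: ugen; rewrite /cone_lattice /= spW extend_scalarsM; apply/WP.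
    by exists (extend_scalars R U).
  (* the image of the normal of s is k times the normal of the cell, with k > 0
     because both have positive coordinates along v *)
  have ck : c = k%:~R * c'.
    apply: (coord_uniq vT UcF).
    have -> : extend_scalars R (U *m F) - (k%:~R * c') *: v =
      (extend_scalars R (U *m F) - k%:~R *: extend_scalars R u) +
      k%:~R *: (extend_scalars R u - c' *: v).
      by move: (extend_scalars R (U *m F)) => a; apply/rowP => j; rewrite !mxE; ring.
    rewrite memvD ?memvZ //.
    by rewrite -extend_scalars_mulz -extend_scalarsN -extend_scalarsD.
  have k0 : 0 < k by rewrite -(ltr0z R) -(pmulr_lgt0 _ c'0) -ck.
  case: k k0 Uk ck => // k k0; rewrite -pmulrn => Uk ck.
  have -> : lattice_index s (cell A (y + e *: v)) = (k * lattice_index m (cell A y))%N.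
    rewrite /lattice_index sE; rewrite sE in inj ln.
    have onto : spans_onto F (cell H p) (cell A (y + e *: v)).
      by move=> z; rewrite spW -sE; exact: WP.
    have onto' : spans_onto F (cell H P) (cell A y).
      by move=> z; rewrite -/T TE; exact: W0P.
    exact: (index_facet pP yp dms dk inj onto onto' ln lk).
  set N := lattice_index m _.
  have -> : (k * N)%:R *: extend_scalars R u - N%:R *: (extend_scalars R U *m FR) =
     - (N%:R *: (extend_scalars R (U *m F - u *+ k))).
    rewrite extend_scalarsD extend_scalarsN [u *+ k]pmulrn.
    rewrite extend_scalars_mulz extend_scalarsM.
    rewrite natrM; move: (extend_scalars R U *m FR) => a.
    by apply/rowP => j; rewrite !mxE; ring.
  by rewrite memvN memvZ.
Qed.

End PushForward.

Lemma raddf_fsbig (U V : zmodType) (f : {additive U -> V}) (I : choiceType)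
    (P : set I) (g : I -> U) : finite_set P ->
  f (\sum_(i \in P) g i) = \sum_(i \in P) f (g i).
Proof. by move=> finP; rewrite !fsbig_finite // raddf_sum. Qed.

Lemma exchange_fsbig_rel (V : zmodType) (I J : choiceType) (P : set I) (Q : set J)
    (E : I -> set J) (g : I -> J -> V) : finite_set P -> finite_set Q ->
  \sum_(i \in P) \sum_(j \in Q `&` E i) g i j =
  \sum_(j \in Q) \sum_(i \in P `&` [set i | E i j]) g i j.
Proof.
move=> finP finQ; under eq_fsbigr do rewrite fsbig_mkcondr.
rewrite exchange_fsbig //; apply: eq_fsbigr => j _; rewrite fsbig_mkcondr.
apply: eq_fsbigr => i _.
suff -> : (i \in [set i | E i j]) = (j \in E i) by [].
by apply/idP/idP; rewrite !inE.
Qed.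

Lemma finite_star (R : realType) (r n : nat) (A : seq 'cV[int]_r) (y : 'rV[R]_r) :
  finite_set (star n A y).
Proof. by apply: sub_finite_set (@finite_cells R r A) => k []. Qed.

Section Balancing.
Variables (R : realType) (r r' n : nat) (X : set (set 'rV[R]_r)).
Variables (w : set 'rV[R]_r -> int) (F : 'M[int]_(r, r')) (A : seq 'cV[int]_r').
Hypothesis tropX : is_tropical_fan n X w.
Hypothesis adX : adapted F X A.

Local Notation FR := (extend_scalars R F).

Lemma finite_fan_cones : finite_set (fan_cones X n).
Proof. by have [[[finX _ _ _] _ _] _] := tropX; apply: sub_finite_set finX => s []. Qed.

(** Subtract from the sum over cells, regrouped by the cones [s] of [X], the
    correction terms of [local_balance]; regrouped by the facets [t], these
    add up to multiples of images of balancing sums of [X]. *)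
Lemma pushforward_balanced (y : 'rV[R]_r') : (cone_dim (cell A y)).+1 = n ->
  \sum_(k \in star n A y) (pushforward_weight n X F w k)%:~R *:
     extend_scalars R (primitive_normal k (cell A y)) \in cone_span (cell A y).
Proof.
move=> dy; have [[fanX [[_ dimX] _] _] balX] := tropX; have [finX coneX _ _] := fanX.
set T := cone_span (cell A y).
have finF := finite_fan_cones; have finS := finite_star n A y.
have finO : finite_set (facets_over n X F y) by apply: sub_finite_set finX => t [].
pose u (k : set 'rV[R]_r') := extend_scalars R (primitive_normal k (cell A y)).
pose U (s t : set 'rV[R]_r) := extend_scalars R (primitive_normal s t) *m FR.
pose L s := \sum_(k \in star n A y `&` [set k | k `<=` cone_image F s])
  (lattice_index F s k)%:R *: u k.
pose G s := \sum_(t \in facets_over n X F y `&` [set t | is_proper_face t s])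
  (lattice_index F t (cell A y))%:R *: U s t.
have -> : \sum_(k \in star n A y) (pushforward_weight n X F w k)%:~R *: u k =
    \sum_(s \in fan_cones X n) (w s)%:~R *: L s.
  transitivity (\sum_(k \in star n A y)
      \sum_(s \in fan_cones X n `&` [set s | k `<=` cone_image F s])
        (w s)%:~R *: ((lattice_index F s k)%:R *: u k)).
    apply: eq_fsbigr => k _; rewrite /pushforward_weight.
    rewrite !fsbig_finite; try exact: finite_setIl.
    rewrite rmorph_sum scaler_suml; apply: eq_bigr => s _.
    by rewrite rmorphM /= scalerA.
  rewrite exchange_fsbig_rel //; apply: eq_fsbigr => s _.
  by rewrite (raddf_fsbig ( *:%R (w s)%:~R)) //; exact: finite_setIl.
have GT : \sum_(s \in fan_cones X n) (w s)%:~R *: G s \in T.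
  have -> : \sum_(s \in fan_cones X n) (w s)%:~R *: G s =
      \sum_(t \in facets_over n X F y) (lattice_index F t (cell A y))%:R *:
        ((\sum_(s \in fan_cones X n `&` [set s | is_proper_face t s])
           (w s)%:~R *: extend_scalars R (primitive_normal s t)) *m FR).
    transitivity (\sum_(s \in fan_cones X n)
        \sum_(t \in facets_over n X F y `&` [set t | is_proper_face t s])
          (w s)%:~R *: ((lattice_index F t (cell A y))%:R *: U s t)).
      apply: eq_fsbigr => s _.
      by rewrite (raddf_fsbig ( *:%R (w s)%:~R)) //; exact: finite_setIl.
    rewrite exchange_fsbig_rel //; apply: eq_fsbigr => t _.
    rewrite !fsbig_finite; try exact: finite_setIl.
    rewrite mulmx_suml scaler_sumr; apply: eq_bigr => s _.
    by rewrite -scalemxAl !scalerA mulrC.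
  rewrite fsbig_finite // big_seq memv_suml // => t.
  rewrite in_fset_set // inE => -[Xt dt [P tP PF]]; rewrite memvZ //.
  have [W WP] := adapted_span adX Xt (mem_span tP).
  rewrite PF -/T => -[TW dW _ _].
  have -> : T = W.
    by apply/eqP; rewrite eqEdim TW -[\dim T]/(cone_dim (cell A y)); lia.
  by apply/WP; eexists; first exact: balX.
have -> : \sum_(s \in fan_cones X n) (w s)%:~R *: L s =
    \sum_(s \in fan_cones X n) (w s)%:~R *: (L s - G s) +
    \sum_(s \in fan_cones X n) (w s)%:~R *: G s.
  rewrite !fsbig_finite // -big_split; apply: eq_bigr => s _ /=.
  by rewrite -scalerDr subrK.
rewrite memvD // fsbig_finite // big_seq memv_suml // => s.
rewrite in_fset_set // inE => Xs; rewrite memvZ //.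
exact: local_balance.
Qed.

End Balancing.

(** * Fans and tropical fans made of cells *)
Section RelativeInterior.
Variables (R : realType) (r : nat).

Lemma eval_continuous (h : 'cV[int]_r) :
  continuous (fun x : 'rV[R]_r => dual_eval h x).
Proof.
have -> : (fun x : 'rV[R]_r => dual_eval h x) =
    (fun x => \sum_(i < r) x 0 i * extend_scalars R h i 0).
  by apply/funext => z; rewrite /dual_eval mxE.
apply: continuous_big => [|i _ x]; first exact: add_continuous.
by apply: (@cvgMl _ _ (nbhs x)); exact: coord_continuous.
Qed.

Lemma relint_cell (H : seq 'cV[int]_r) (y : 'rV[R]_r) : relint (cell H y) y.
Proof.
split; first exact: cell_refl.
have FF : Filter (nbhs y) := nbhs_filter y.
have : \forall z \near y, forall h, h \in H ->
    (0 < dual_eval h y -> 0 < dual_eval h z) /\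
    (dual_eval h y < 0 -> dual_eval h z < 0).
  elim: H => [|h H IH]; first exact: (@filterE _ _ FF).
  have hz : \forall z \near y, (0 < dual_eval h y -> 0 < dual_eval h z) /\
      (dual_eval h y < 0 -> dual_eval h z < 0).
    have [h0|h0|h0] := ltgtP (dual_eval h y) 0; last exact: (@filterE _ _ FF).
      have := @cvgr_lt R _ (nbhs y) FF _ _ (@eval_continuous h y) 0 h0.
      by move=> P; apply: (@filterS _ _ FF _ _ _ P) => z zh; split.
    have := @cvgr_gt R _ (nbhs y) FF _ _ (@eval_continuous h y) 0 h0.
    by move=> P; apply: (@filterS _ _ FF _ _ _ P) => z zh; split.
  apply: (@filterS2 _ _ FF _ _ _ _ hz IH) => z zh zH h'; rewrite inE.
  by move=> /orP[/eqP ->//|]; exact: zH.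
move=> P; apply: (@filterS _ _ FF _ _ _ P) => z zH /mem_cell_span fz h hH.
have [z1 z2] := zH h hH.
have [h0|h0|h0] := ltgtP (dual_eval h y) 0.
- by split=> // _; rewrite ltW // z2.
- by split=> // _; rewrite ltW // z1.
- by rewrite fz // lexx.
Qed.

End RelativeInterior.

Section FansOfCells.
Variables (R : realType) (r : nat) (A : seq 'cV[int]_r).
Implicit Types (x y : 'rV[R]_r) (U : set 'rV[R]_r).

Definition cells_of U : set (set 'rV[R]_r) := [set k | exists2 x, U x & k = cell A x].

Lemma cells_of_fan U : (forall x y, U x -> cell A x y -> U y) ->
  is_fan (cells_of U) /\ fan_support (cells_of U) = U.
Proof.
move=> Ucl; split; first split.
- by apply: sub_finite_set (@finite_cells R r A) => _ [x _ ->]; exists x.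
- by move=> _ [x _ ->]; exact: cell_is_cone.
- by move=> _ t [x Ux ->] /face_cell[q xq ->]; exists q => //; exact: Ucl xq.
- have meet x y : is_face (cell A x `&` cell A y) (cell A x).
    have [||||q xq ->] := @subcell R r A x (cell A x `&` cell A y).
    + by move=> z [].
    + by split; exact: cell0.
    + by move=> z z' [xz yz] [xz' yz']; split; exact: cellD.
    + by move=> z [xz yz] z' zz'; split; [exact: cell_trans zz'|exact: cell_trans zz'].
    exact: cell_face.
  by move=> _ _ [x _ ->] [y _ ->]; split; [exact: meet|rewrite setIC; exact: meet].
apply/seteqP; split=> [x [_ [y Uy ->] yx]|x Ux]; first exact: Ucl yx.
by exists (cell A x); [exists x|exact: cell_refl].
Qed.

(** The sum over the [n]-dimensional cells of the fan may be extended to the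
    whole star of a cell, since the weight vanishes on the cells left out. *)
Lemma tropical_of_weights (n : nat) (w : set 'rV[R]_r -> int) :
  let U := [set y | exists x,
    [/\ cone_dim (cell A x) = n, 0 < w (cell A x) & cell A x y]] in
  (forall x, cone_dim (cell A x) = n -> 0 <= w (cell A x)) ->
  (forall y, (cone_dim (cell A y)).+1 = n ->
     \sum_(k \in star n A y) (w k)%:~R *:
       extend_scalars R (primitive_normal k (cell A y)) \in cone_span (cell A y)) ->
  (exists x, U x) ->
  is_tropical_fan n (cells_of U) w /\ fan_support (cells_of U) = U.
Proof.
move=> U w0 bal [x0 Ux0].
have Ucl x y : U x -> cell A x y -> U y.
  by move=> [z [dz wz zx]] xy; exists z; split=> //; exact: cell_trans xy.
have [fanU suppU] := cells_of_fan Ucl; split=> //.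
have Uw k : cells_of U k -> cone_dim k = n -> 0 < w k.
  move=> [y [x [dx wx xy]] ->] dy.
  by rewrite (cell_eq xy) // dx dy.
have pureU : has_pure_dim (cells_of U) n.
  split; first split.
  - have [x [dx wx _]] := Ux0; exists (cell A x); split=> //; exists x => //.
    by exists x; split=> //; exact: cell_refl.
  - by move=> _ [y [x [<- wx xy]] ->]; apply/cone_dim_mono/sub_cell.
  move=> _ [y [x [dx wx xy]] ->] /(_ (cell A x)) <- //; last exact: sub_cell.
  by exists x => //; exists x; split=> //; exact: cell_refl.
split; first by split=> // k [Uk dk]; exact: Uw.
move=> t [y Uy ->] dy.
rewrite (fsbig_widen _ (star n A y)); first exact: bal.
  move=> k [[[x Ux ->] dk] [fk _]]; split; first by exists x.
  split=> //; have [q xq E] := face_cell fk.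
  by apply: (sub_cell xq); rewrite -E; exact: cell_refl.
move=> k [[[x kE] [dk ky]] nk] /=.
suff -> : w k = 0 by rewrite scale0r.
apply/eqP; rewrite eq_le {2}kE w0 -?kE // andbT leNgt; apply/negP => wk.
apply: nk; rewrite kE in dk ky wk *; split.
  by split=> //; exists x => //; exists x; split=> //; exact: cell_refl.
split; first exact: cell_face.
by move=> E; move: dy; rewrite E dk; lia.
Qed.

End FansOfCells.

(** * Fibres over the open cells *)
Section FanPoints.
Variables (R : realType) (r n : nat) (X : set (set 'rV[R]_r)) (P : 'rV[R]_r).
Hypothesis fanX : is_fan X.
Hypothesis dimP : forall s, X s -> s P -> cone_dim s = n.

(** The intersection of two cones of the fan through [P] is a face of both and
    contains [P], hence is [n]-dimensional and equal to both. *)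
Lemma cone_through_unique s s' : X s -> X s' -> s P -> s' P -> s = s'.
Proof.
have [_ coneX faceX interX] := fanX.
have half t t' : X t -> X t' -> t P -> t' P -> is_face (t `&` t') t -> t `&` t' = t.
  move=> Xt Xt' tP t'P; move: (dimP Xt tP).
  have [H [p tE]] := cone_is_cell (coneX _ Xt).
  move=> dt /[dup] ft; rewrite {2}tE => /face_cell[q pq qE].
  have dq := dimP (faceX _ _ Xt ft) (conj tP t'P).
  by rewrite qE tE; apply: cell_eq => //; rewrite -tE -qE dt dq.
move=> Xs Xs' sP s'P; have [f1 f2] := interX _ _ Xs Xs'.
rewrite -(half _ _ Xs Xs' sP s'P f1) setIC.
by apply: half => //; rewrite setIC.
Qed.

(** The face of [s] with [P] in its interior contains [P], so that it is [s]. *)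
Lemma cone_through_relint s : X s -> s P -> relint s P.
Proof.
have [_ coneX _ _] := fanX.
move=> Xs; have [H [p sE]] := cone_is_cell (coneX _ Xs); rewrite sE in Xs * => sP.
have XP := fan_cell fanX Xs sP.
have <- : cell H P = cell H p.
  by apply: cell_eq => //; rewrite (dimP Xs sP) (dimP XP) //; exact: cell_refl.
exact: relint_cell.
Qed.

End FanPoints.

Section Fibers.
Variables (R : realType) (r r' n : nat) (X : set (set 'rV[R]_r)).
Variables (w : set 'rV[R]_r -> int) (F : 'M[int]_(r, r')) (A : seq 'cV[int]_r').
Hypothesis tropX : is_tropical_fan n X w.
Hypothesis adX : adapted F X A.
Implicit Types (s : set 'rV[R]_r) (P : 'rV[R]_r) (Q : 'rV[R]_r').

Local Notation FR := (extend_scalars R F).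

Definition cone_through P : set 'rV[R]_r := xget set0 [set s | fan_cones X n s /\ s P].

Let fanX : is_fan X. Proof. by have [[]] := tropX. Qed.
Let dimX s : X s -> (cone_dim s <= n)%N.
Proof. by have [[_ [[_ +] _] _] _] := tropX; apply. Qed.

(** The image of the span of [s] contains the [n]-dimensional span of the cell
    of the image point, while [s] has dimension at most [n]. *)
Lemma cone_over_chamber s P : X s -> s P -> cone_dim (cell A (P *m FR)) = n ->
  [/\ cone_dim s = n, injective_on F s, spans_onto F s (cell A (P *m FR)) &
      cell A (P *m FR) `<=` cone_image F s].
Proof.
move=> Xs sP dQ; have [W _ [QW dW injW _]] := adapted_span adX Xs (mem_span sP).
have dnW := dimvS QW; rewrite -/(cone_dim (cell A (P *m FR))) dQ in dnW.
have dn := dimX Xs; have inj : injective_on F s by apply/injW; lia.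
have sub := adapted_image adX Xs inj sP.
by have [_ [onto ds]] := image_inj dimX sub dQ Xs.
Qed.

Lemma cone_throughP P : fan_support X P -> cone_dim (cell A (P *m FR)) = n ->
  fan_cones X n (cone_through P) /\ cone_through P P.
Proof.
move=> [s Xs sP] dQ; rewrite /cone_through; case: xgetP => [t -> //|no].
by case: (no s); split=> //; split=> //; have [] := cone_over_chamber Xs sP dQ.
Qed.

Lemma cone_through_eq s P : X s -> s P -> cone_dim (cell A (P *m FR)) = n ->
  cone_through P = s.
Proof.
move=> Xs sP dQ; have [[Xt _] tP] := cone_throughP (ex_intro2 _ _ s Xs sP) dQ.
have dP u : X u -> u P -> cone_dim u = n.
  by move=> Xu uP; have [] := cone_over_chamber Xu uP dQ.
exact: (cone_through_unique fanX dP Xt Xs tP sP).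
Qed.

Lemma cone_through_relintP P : fan_support X P -> cone_dim (cell A (P *m FR)) = n ->
  relint (cone_through P) P.
Proof.
move=> XP dQ; have [[Xt _] tP] := cone_throughP XP dQ.
have dP u : X u -> u P -> cone_dim u = n.
  by move=> Xu uP; have [] := cone_over_chamber Xu uP dQ.
exact: (cone_through_relint fanX dP Xt tP).
Qed.

(** [F] is injective on each cone, so a cone contains at most one point of the
    fibre; every point of the fibre lies in a unique cone. *)
Lemma cone_through_bij Q : cone_dim (cell A Q) = n ->
  set_bij (fiber X F Q)
    (fan_cones X n `&` [set s | cell A Q `<=` cone_image F s]) cone_through.
Proof.
move=> dQ; split.
- move=> P [XP PQ]; rewrite -PQ in dQ *; have [Xt tP] := cone_throughP XP dQ.
  by split=> //; have [] := cone_over_chamber Xt.1 tP dQ.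
- move=> P P' /set_mem[XP PQ] /set_mem[XP' P'Q] E.
  have dP : cone_dim (cell A (P *m FR)) = n by rewrite PQ.
  have dP' : cone_dim (cell A (P' *m FR)) = n by rewrite P'Q.
  have [[Xt _] tP] := cone_throughP XP dP; have [_ tP'] := cone_throughP XP' dP'.
  have [_ inj _ _] := cone_over_chamber Xt tP dP; rewrite -E in tP'.
  by apply: (injective_onP inj); rewrite ?mem_span // PQ P'Q.
move=> s [[Xs _] /(_ Q (cell_refl A Q))[P sP PQ]]; exists P.
  by split=> //; exists s.
by apply: cone_through_eq => //; rewrite PQ.
Qed.

Lemma finite_fiber Q : cone_dim (cell A Q) = n -> finite_set (fiber X F Q).
Proof.
move=> dQ; have bij := cone_through_bij dQ.
have /card_set_bijP/eq_finite_set -> : exists g, set_bij (fiber X F Q)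
    (fan_cones X n `&` [set s | cell A Q `<=` cone_image F s]) g.
  by eexists; exact: bij.
by apply: finite_setIl; exact: finite_fan_cones tropX.
Qed.

Lemma pushforward_fiber Q : cone_dim (cell A Q) = n ->
  pushforward_weight n X F w (cell A Q) =
  \sum_(P \in fiber X F Q)
    w (cone_through P) * (lattice_index F (cone_through P) (cell A Q))%:Z.
Proof. by move=> dQ; apply/reindex_fsbig/cone_through_bij. Qed.

Lemma pushforward_weight_ge0 k : 0 <= pushforward_weight n X F w k.
Proof.
have [[_ _ w0] _] := tropX.
by apply: fsumr_ge0 => s [/w0/ltW Xs _]; rewrite mulr_ge0.
Qed.

End Fibers.

(** * Comparison with the weights of an irreducible fan *)
Section Identity.
Variables (R : realType) (r n : nat) (Y : set (set 'rV[R]_r)).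
Variables (w : set 'rV[R]_r -> int) (A : seq 'cV[int]_r).
Hypothesis tropY : is_tropical_fan n Y w.
Hypothesis adY : adapted 1%:M Y A.

Lemma mul_extend1 (x : 'rV[R]_r) : x *m extend_scalars R 1%:M = x.
Proof. by rewrite /extend_scalars map_scalar_mx /= mulmx1. Qed.

Lemma adapted1_cell s x : Y s -> s x -> cell A x `<=` s.
Proof.
move=> Ys sx z xz; have inj : injective_on 1%:M s by move=> v _; rewrite mul_extend1.
have := adY.2 s Ys inj x sx z; rewrite !mul_extend1 => /(_ xz)[z' sz' ->].
by rewrite mul_extend1.
Qed.

(** The push-forward along the identity is the transport of the weights to the
    cells: only the cone containing the cell contributes, with index one. *)
Lemma pushforward1 Q : fan_support Y Q -> cone_dim (cell A Q) = n ->
  pushforward_weight n Y 1%:M w (cell A Q) = w (cone_through n Y Q).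
Proof.
move=> YQ dQ; rewrite (pushforward_fiber tropY adY dQ).
have -> : fiber Y 1%:M Q = [set Q].
  by apply/seteqP; split=> [P [_]|P ->]; rewrite /fiber /= mul_extend1.
have dQ1 : cone_dim (cell A (Q *m extend_scalars R 1%:M)) = n by rewrite mul_extend1.
have [[Yt dt] tQ] := cone_throughP tropY adY YQ dQ1.
rewrite fsbig_set1 /lattice_index; set t := cone_through n Y Q in Yt dt tQ *.
have spE : cone_span (cell A Q) = cone_span t.
  by apply: cone_span_eq; [exact: adapted1_cell|rewrite dt].
have -> : cone_lattice (cell A Q) = cone_lattice t by rewrite /cone_lattice spE.
have -> : lattice_image 1%:M t = cone_lattice t.
  apply/seteqP; split=> [_ [z tz <-]|z tz]; first by rewrite mulmx1.
  by exists z; rewrite ?mulmx1.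
by rewrite quotient_order_refl ?mulr1 //; exact: cone_lattice_subgroup.
Qed.

End Identity.

Lemma finite_argmin (T : choiceType) (S : set T) (g : T -> rat) :
  finite_set S -> S !=set0 -> exists2 x, S x & forall y, S y -> g x <= g y.
Proof.
move=> /finite_fsetP[B ->] [x0 Bx0].
pose m := [arg min_(b < [` Bx0]%fset) g (val b)]%O.
have mP : forall b : B, g (val m) <= g (val b).
  by rewrite /m; case: arg_minP => // b _ bmin b'; exact: bmin.
by exists (val m) => [|y By]; [exact: valP|exact: (mP [` By]%fset)].
Qed.

(** Subtract from [w] the largest multiple of [w'] that leaves a nonnegative
    weight [om], scaled to be integral.  It is balanced and vanishes on a cell
    inside |Y|, so by irreducibility it cannot be positive anywhere. *)
Lemma irreducible_weight_unique (R : realType) (r n : nat)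
    (Y : set (set 'rV[R]_r)) (A : seq 'cV[int]_r) (w w' : set 'rV[R]_r -> int) :
  irreducible_fan n Y ->
  (forall x y, fan_support Y x -> cell A x y -> fan_support Y y) ->
  (forall v, v \in [:: w; w'] -> [/\ forall k, 0 <= v k,
     forall x, ~ fan_support Y x -> v (cell A x) = 0 &
     forall y, (cone_dim (cell A y)).+1 = n ->
     \sum_(k \in star n A y) (v k)%:~R *:
       extend_scalars R (primitive_normal k (cell A y)) \in cone_span (cell A y)]) ->
  (forall x, fan_support Y x -> cone_dim (cell A x) = n -> 0 < w' (cell A x)) ->
  exists d : rat, forall x, fan_support Y x -> cone_dim (cell A x) = n ->
    (w (cell A x))%:~R = d * (w' (cell A x))%:~R.
Proof.
move=> irr Ycl wP w'pos.
have [|w0 wY wbal] := wP w; first by rewrite inE eqxx.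
have [|w'0 w'Y w'bal] := wP w'; first by rewrite !inE eqxx orbT.
pose S := [set k | exists x,
  [/\ fan_support Y x, cone_dim (cell A x) = n & k = cell A x]].
have [[k0 Sk0]|noS] := pselect (S !=set0); last first.
  by exists 0 => x Yx dx; case: noS; exists (cell A x); exists x.
have finS : finite_set S.
  by apply: sub_finite_set (@finite_cells R r A) => _ [x [_ _ ->]]; exists x.
pose g k : rat := (w k)%:~R / (w' k)%:~R.
have [] := @finite_argmin _ S g finS; first by exists k0.
move=> _ [x0 [Yx0 dx0 ->]] gmin; set c0 := cell A x0.
have p0 : 0 < w' c0 by exact: w'pos.
have p0Q : 0 < (w' c0)%:~R :> rat by rewrite ltr0z.
(* g k - g c0 with denominators cleared *)
pose om k := w' c0 * w k - w c0 * w' k.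
have om_out x : ~ fan_support Y x -> om (cell A x) = 0.
  by move=> nYx; rewrite /om wY // w'Y // !mulr0 subr0.
have om_ge0 x : cone_dim (cell A x) = n -> 0 <= om (cell A x).
  move=> dx; have [Yx|/om_out -> //] := pselect (fan_support Y x).
  have : g c0 <= g (cell A x) by apply: gmin; exists x.
  have px : 0 < (w' (cell A x))%:~R :> rat by rewrite ltr0z w'pos.
  rewrite /g ler_pdivrMr // mulrAC ler_pdivlMr // -!intrM ler_int /om.
  by rewrite subr_ge0 [X in _ <= X]mulrC.
have om_bal y : (cone_dim (cell A y)).+1 = n ->
     \sum_(k \in star n A y) (om k)%:~R *:
       extend_scalars R (primitive_normal k (cell A y)) \in cone_span (cell A y).
  move=> dy; have finS' := finite_star n A y.
  have -> : \sum_(k \in star n A y) (om k)%:~R *: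
       extend_scalars R (primitive_normal k (cell A y)) =
     (w' c0)%:~R *: \sum_(k \in star n A y) (w k)%:~R *:
       extend_scalars R (primitive_normal k (cell A y)) -
     (w c0)%:~R *: \sum_(k \in star n A y) (w' k)%:~R *:
       extend_scalars R (primitive_normal k (cell A y)).
    rewrite !fsbig_finite // !scaler_sumr -sumrB; apply: eq_bigr => k _.
    by rewrite !scalerA -scalerBl -!intrM -intrB.
  by rewrite memvB // memvZ ?wbal ?w'bal.
exists (g c0) => x Yx dx.
suff : om (cell A x) = 0.
  move=> /eqP; rewrite subr_eq0 => /eqP E.
  rewrite /g mulrAC; apply/(canRL (mulfK _)); first by rewrite gt_eqF.
  by rewrite -!intrM -E mulrC.
apply/eqP; rewrite eq_le om_ge0 // andbT leNgt; apply/negP => omx.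
have [|tropZ suppZ] := tropical_of_weights om_ge0 om_bal.
  by exists x, x; split=> //; exact: cell_refl.
apply: irr; eexists; exists om; split; first exact: tropZ.
rewrite suppZ; split=> [y [z [dz omz zy]]|sub].
  apply: Ycl zy; apply: contrapT => /om_out E.
  by move: omz; rewrite E ltxx.
have [z [dz omz zx0]] := sub _ Yx0.
have cE : cell A z = c0 by apply/esym/cell_eq => //; rewrite dz dx0.
by move: omz; rewrite cE /om mulrC subrr ltxx.
Qed.

Theorem corollary2p26 (R : realType) (r r' n : nat)
    (X : set (set 'rV[R]_r)) (wX : set 'rV[R]_r -> int)
    (Y : set (set 'rV[R]_r')) (wY : set 'rV[R]_r' -> int)
    (f : 'M[int]_(r, r')) :
  is_tropical_fan n X wX ->
  is_tropical_fan n Y wY ->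
  is_fan_morphism X Y f ->
  irreducible_fan n Y ->
  exists (Y0 : set (set 'rV[R]_r'))
         (sigma : 'rV[R]_r -> set 'rV[R]_r)
         (sigma' : 'rV[R]_r' -> set 'rV[R]_r'),
    [/\ [/\ is_fan Y0, fan_dim_lt Y0 n & fan_support Y0 `<=` fan_support Y],
        forall Q, (fan_support Y `\` fan_support Y0) Q ->
          fan_cones Y n (sigma' Q) /\ relint (sigma' Q) Q,
        forall P, fan_support X P ->
          (fan_support Y `\` fan_support Y0) (P *m extend_scalars R f) ->
          fan_cones X n (sigma P) /\ relint (sigma P) P
      & exists d : rat, forall Q, (fan_support Y `\` fan_support Y0) Q ->
          [/\ finite_set (fiber X f Q),
              forall P, fiber X f Q P ->
                lattice_image f (sigma P) `<=` cone_lattice (sigma' Q) /\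
                finite_set (quotient_set (cone_lattice (sigma' Q))
                                         (lattice_image f (sigma P)))
            & \sum_(P \in fiber X f Q)
                multiplicity wX wY f (sigma P) (sigma' Q) = d]].
Proof.
move=> tX tY fXY irr.
have [[[finX coneX _ _] _ _] _] := tX.
have [[[finY coneY _ _] [[_ dimY] _] posY] _] := tY.
have [A1 ad1] := adapted_exists f finX coneX.
have [A2 ad2] := adapted_exists 1%:M finY coneY.
pose A := A1 ++ A2.
have adX : adapted f X A by apply: adapted_sub ad1 => h hA; rewrite mem_cat hA.
have adY : adapted 1%:M Y A.
  by apply: adapted_sub ad2 => h hA; rewrite mem_cat hA orbT.
have Ycl x y : fan_support Y x -> cell A x y -> fan_support Y y.
  by move=> [s Ys sx] xy; exists s => //; apply: (adapted1_cell adY Ys sx).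
pose U := [set y | fan_support Y y /\ (cone_dim (cell A y) < n)%N].
have Ucl x y : U x -> cell A x y -> U y.
  move=> [Yx dx] xy; split; first exact: Ycl xy.
  exact: leq_ltn_trans (cone_dim_mono (sub_cell xy)) dx.
have [fanU suppU] := cells_of_fan Ucl.
have good Q : (fan_support Y `\` fan_support (cells_of A U)) Q ->
    fan_support Y Q /\ cone_dim (cell A Q) = n.
  rewrite suppU => -[/[dup] YQ [s Ys sQ] nUQ]; split=> //.
  have := leq_trans (cone_dim_mono (adapted1_cell adY Ys sQ)) (dimY _ Ys).
  rewrite leq_eqVlt => /orP[/eqP //|dQ].
  by case: nUQ.
have mul1 Q : cone_dim (cell A Q) = n ->
    cone_dim (cell A (Q *m extend_scalars R 1%:M)) = n by rewrite mul_extend1.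
exists (cells_of A U), (cone_through n X), (cone_through n Y).
pose NX := pushforward_weight n X f wX; pose NY := pushforward_weight n Y 1%:M wY.
have NYE Q : fan_support Y Q -> cone_dim (cell A Q) = n ->
    NY (cell A Q) = wY (cone_through n Y Q) by exact: pushforward1.
have NYpos Q : fan_support Y Q -> cone_dim (cell A Q) = n -> 0 < NY (cell A Q).
  move=> YQ dQ; rewrite NYE //; apply: posY.
  by have [] := cone_throughP tY adY YQ (mul1 _ dQ).
have out (q : nat) (Z : set (set 'rV[R]_q)) (F : 'M[int]_(q, r')) wZ x :
    is_fan_morphism Z Y F -> ~ fan_support Y x ->
    pushforward_weight n Z F wZ (cell A x) = 0.
  move=> ZY nYx; rewrite /pushforward_weight (_ : _ `&` _ = set0) ?fsbig_set0 //.
  rewrite -subset0 => s [[Zs _] /(_ x (cell_refl A x))[P sP Px]].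
  by apply: nYx; rewrite -Px; apply: ZY; exists s.
have [d dP] : exists d : rat, forall x, fan_support Y x ->
    cone_dim (cell A x) = n -> (NX (cell A x))%:~R = d * (NY (cell A x))%:~R.
  apply: (irreducible_weight_unique irr Ycl) => //.
  move=> v; rewrite !inE => /orP[]/eqP ->; split.
  - by move=> k; exact: pushforward_weight_ge0 tX k.
  - by move=> x; exact: out.
  - by move=> y; exact: pushforward_balanced tX adX y.
  - by move=> k; exact: pushforward_weight_ge0 tY k.
  - by move=> x; apply: out => z; rewrite mul_extend1.
  - by move=> y; exact: pushforward_balanced tY adY y.
split.
- split=> // [_ [y [_ dy] ->] //|]; by rewrite suppU => y [].
- move=> Q /good[YQ dQ].
  have [] := cone_throughP tY adY YQ (mul1 _ dQ); split=> //.
  exact: cone_through_relintP tY adY _ YQ (mul1 _ dQ).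
- move=> P XP /good[_ dQ].
  have [] := cone_throughP tX adX XP dQ; split=> //.
  exact: cone_through_relintP tX adX _ XP dQ.
exists d => Q /good[YQ dQ].
have [Yt tQ] := cone_throughP tY adY YQ (mul1 _ dQ).
set t := cone_through n Y Q in Yt tQ *.
have spE : cone_span (cell A Q) = cone_span t.
  by apply: cone_span_eq; [exact: (adapted1_cell adY Yt.1 tQ)|rewrite dQ Yt.2].
have lattE : cone_lattice t = cone_lattice (cell A Q) by rewrite /cone_lattice spE.
split; first exact: (finite_fiber tX adX dQ).
  move=> P [XP PQ]; rewrite lattE.
  have dPQ : cone_dim (cell A (P *m extend_scalars R f)) = n by rewrite PQ.
  have [Xs sP] := cone_throughP tX adX XP dPQ.
  have [_ inj onto _] := cone_over_chamber tX adX Xs.1 sP dPQ.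
  rewrite PQ in onto; split.
    by apply: lattice_image_sub => x xs; apply/onto; exists x.
  have [H [p sE]] := cone_is_cell (coneX _ Xs.1).
  by rewrite sE in inj onto *; exact: finite_index.
have wt : (wY t)%:~R != 0 :> rat by rewrite intr_eq0 gt_eqF // posY.
have /(canRL (mulfK wt)) -> : d * (wY t)%:~R = (NX (cell A Q))%:~R.
  by rewrite dP // NYE.
rewrite /NX (pushforward_fiber tX adX dQ) (raddf_fsbig intr); last first.
  exact: (finite_fiber tX adX dQ).
rewrite mulr_fsuml; apply: eq_fsbigr => P _.
by rewrite /multiplicity lattE /= intrM mulrAC.
Qed.
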